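(* Let $g \geq 2$, let $F$ be the free group on $a_1,\dots,a_{2g}$, let $w = [a_1,a_2]\cdots[a_{2g-1},a_{2g}]$, and let $\langle\langle w\rangle\rangle_F$ be the normal closure of $w$ in $F$ (so $\Gamma_g = F/\langle\langle w\rangle\rangle_F$ is the genus $g$ surface group). Let $N$ be a normal subgroup of $F$ such that $G = F/N$ satisfies $G/\gamma_k(G) \cong \Gamma_g/\gamma_k(\Gamma_g)$ for all $k \geq 1$. (i) If there is an automorphism $\phi$ of $F$ with $\phi(N) \supseteq \langle\langle w\rangle\rangle_F$, then $G \cong \Gamma_g$. (ii) If there is an automorphism $\phi$ of $F$ with $\phi(N)$ a proper subgroup of $\langle\langle w\rangle\rangle_F$, then $G$ is not residually nilpotent.
   Context: $\gamma_k$ denotes the lower central series: $\gamma_1(G)=G$, $\gamma_k(G)=[G,\gamma_{k-1}(G)]$. $[x,y]$ denotes the commutator. A group is residually nilpotent if the intersection of all $\gamma_k(G)$ is trivial. *)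

(* Defs.v *)
(* Infinite groups are modelled
   as "setoid groups": a carrier with an equality relation and operations;
   quotients G/N are then the same carrier with the coarser relation
   x ~ y  <->  x^-1 y \in N. *)
From mathcomp Require Import all_boot.
Set Implicit Arguments. Unset Strict Implicit. Unset Printing Implicit Defensive.

Record sgroup := SGroup {
  car :> Type;
  geq : car -> car -> Prop;
  gmul : car -> car -> car;
  ginv : car -> car;
  gone : car }.

Arguments geq {s}. Arguments gmul {s}. Arguments ginv {s}. Arguments gone {s}.

Definition is_group (G : sgroup) : Prop :=
  [/\ (forall x : G, geq x x),
      (forall x y : G, geq x y -> geq y x),
      (forall x y z : G, geq x y -> geq y z -> geq x z),
      (forall x x' y y' : G, geq x x' -> geq y y' -> geq (gmul x y) (gmul x' y')) &
      [/\ (forall x x' : G, geq x x' -> geq (ginv x) (ginv x')),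
      (forall x y z : G, geq (gmul (gmul x y) z) (gmul x (gmul y z))),
      (forall x : G, geq (gmul gone x) x) &
      (forall x : G, geq (gmul (ginv x) x) gone)]].

Section Free.
Variable A : Type.
Definition word := seq (A * bool).   (* (a, false) = a, (a, true) = a^-1 *)

Inductive freeq : word -> word -> Prop :=
| fq_red u v a b : freeq (u ++ (a, b) :: (a, ~~ b) :: v) (u ++ v)
| fq_refl u : freeq u u
| fq_sym u v : freeq u v -> freeq v u
| fq_trans u v w : freeq u v -> freeq v w -> freeq u w.

Definition winv (u : word) : word := rev (map (fun p => (p.1, ~~ p.2)) u).

Definition free_group : sgroup := SGroup freeq (@cat _) winv [::].
End Free.

Lemma freeq_catl A (u v w : word A) : freeq u v -> freeq (w ++ u) (w ++ v).
Proof.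
elim=> [u1 v1 a b| u1 | u1 v1 _ IH | u1 v1 w1 _ IH1 _ IH2].
- by rewrite !catA; apply: fq_red.
- exact: fq_refl.
- exact: fq_sym.
- exact: fq_trans IH1 IH2.
Qed.

Lemma freeq_catr A (u v w : word A) : freeq u v -> freeq (u ++ w) (v ++ w).
Proof.
elim=> [u1 v1 a b| u1 | u1 v1 _ IH | u1 v1 w1 _ IH1 _ IH2].
- by rewrite -!catA /=; apply: fq_red.
- exact: fq_refl.
- exact: fq_sym.
- exact: fq_trans IH1 IH2.
Qed.

Lemma freeq_inv A (u v : word A) : freeq u v -> freeq (winv u) (winv v).
Proof.
elim=> [u1 v1 a b| u1 | u1 v1 _ IH | u1 v1 w1 _ IH1 _ IH2].
- rewrite /winv !map_cat !rev_cat /= !rev_cons -!cats1 -!catA /=.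
  by rewrite -{2}[b]negbK; apply: fq_red.
- exact: fq_refl.
- exact: fq_sym.
- exact: fq_trans IH1 IH2.
Qed.

Lemma free_group_is_group A : is_group (free_group A).
Proof.
split; last split; rewrite /=.
- exact: fq_refl.
- exact: fq_sym.
- exact: fq_trans.
- move=> x x' y y' hx hy; apply: fq_trans (freeq_catr y hx) _; exact: freeq_catl.
- exact: freeq_inv.
- by move=> x y z; rewrite catA; apply: fq_refl.
- by move=> x; apply: fq_refl.
- elim=> [|[a b] x IH]; first exact: fq_refl.
  rewrite /winv /= rev_cons -cats1 -catA /=.
  apply: fq_trans _ IH; rewrite /winv.
  by have := fq_red (rev (map (fun p => (p.1, ~~ p.2)) x)) x a (~~ b); rewrite negbK.
Qed.

Section Sub.
Variable G : sgroup.

Inductive gen (S : G -> Prop) : G -> Prop :=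
| gen_in x : S x -> gen S x
| gen_one : gen S gone
| gen_mul x y : gen S x -> gen S y -> gen S (gmul x y)
| gen_inv x : gen S x -> gen S (ginv x)
| gen_eq x y : geq x y -> gen S x -> gen S y.

Definition comm (x y : G) : G := gmul (gmul (ginv x) (ginv y)) (gmul x y).
Definition conj (x g : G) : G := gmul (gmul (ginv g) x) g.

Definition is_normal (N : G -> Prop) : Prop :=
  [/\ N gone,
      (forall x y, N x -> N y -> N (gmul x y)),
      (forall x, N x -> N (ginv x)),
      (forall x y, geq x y -> N x -> N y) &
      (forall x g, N x -> N (conj x g))].

Definition ncl (S : G -> Prop) : G -> Prop :=
  gen (fun z => exists s g, S s /\ z = conj s g).

Definition commsub (P Q : G -> Prop) : G -> Prop :=
  gen (fun z => exists x y, P x /\ Q y /\ z = comm x y).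

Fixpoint lcs (k : nat) : G -> Prop :=
  match k with
  | 0 => fun _ => True
  | k.+1 => commsub (fun _ => True) (lcs k)
  end.

(* gamma_1(G) = G, gamma_k(G) = [G, gamma_(k-1)(G)] *)
Definition gamma (k : nat) : G -> Prop := lcs k.-1.

Definition residually_nilpotent : Prop :=
  forall x : G, (forall k, 1 <= k -> gamma k x) -> geq x gone.

End Sub.

Definition quot (G : sgroup) (N : G -> Prop) : sgroup :=
  SGroup (fun x y : G => N (gmul (ginv x) y)) gmul ginv gone.

Definition is_iso (G H : sgroup) (f : G -> H) : Prop :=
  [/\ (forall x y, geq x y -> geq (f x) (f y)),
      (forall x y, geq (f (gmul x y)) (gmul (f x) (f y))),
      (forall x y, geq (f x) (f y) -> geq x y) &
      (forall h, exists x, geq (f x) h)].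

Definition isomorphic (G H : sgroup) : Prop := exists f : G -> H, is_iso f.

Definition gimage (G H : sgroup) (f : G -> H) (N : G -> Prop) : H -> Prop :=
  fun y => exists x, N x /\ geq (f x) y.

(* generators a_1..a_(2g) are indexed by 'I_g * bool:
   (i, false) = a_(2i+1), (i, true) = a_(2i+2)  (i 0-based) *)
Definition Fg (g : nat) : sgroup := free_group ('I_g * bool).

Definition gen_letter g (i : 'I_g) (b : bool) : Fg g := [:: ((i, b), false)].

Definition surface_rel (g : nat) : Fg g :=
  foldr (fun (i : 'I_g) (r : Fg g) =>
           gmul (comm (gen_letter i false) (gen_letter i true)) r)
        gone (enum 'I_g).

Arguments surface_rel : clear implicits.
Definition wncl (g : nat) : Fg g -> Prop := @ncl (Fg g) (fun s : Fg g => s = surface_rel g).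

Arguments wncl : clear implicits.
Definition Gamma (g : nat) : sgroup := quot (wncl g).
Arguments lcs : clear implicits.
Arguments gamma : clear implicits.
Arguments residually_nilpotent : clear implicits.

(* Main.v *)
Require Import Defs.
From mathcomp Require Import all_boot all_order all_algebra.
From mathcomp Require Import zify ring.
From Stdlib Require Import Classical ClassicalEpsilon FunctionalExtensionality.
Import Order.TTheory GRing.Theory Num.Theory.
(* [ssrnat] also has a [geq]. *)
Import Defs.
Set Implicit Arguments. Unset Strict Implicit. Unset Printing Implicit Defensive.

(* Transporting along phi, both parts compare normal subgroups M1 <= M2 of F
   (one of them being <<w>>) whose quotients have isomorphic nilpotent
   quotients. Finitely generated nilpotent groups are Hopfian, because they
   satisfy the ascending chain condition on subgroups, so M2 lies in
   M1 gamma_k(F) for all k. Hence M1 = M2 as soon as F/M1 is residually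
   nilpotent. In (ii) this is the statement; in (i) F/M1 is the surface group,
   and its residual nilpotence is shown as follows.

   With a = a_1, b = a_2 and r the product of the other commutators, the
   defining relation reads a^-1 b a = b r. Hence the kernel K of the
   exponent-sum map in a is free on b and the conjugates a^-j x a^j of the
   other generators x, and the surface group is K extended by <a>, where
   conjugation by a shifts j and sends b to b r. It acts on sequences
   (f_i) of functions of a "time" j in Z: a shifts the time, and K acts at each
   time by a Magnus-type unitriangular action f_{i+1} += c f_i. When the
   coefficients c are polynomial in j, this action is unipotent for a filtration
   by degree, so the intersection of the gamma_k acts trivially on polynomials;
   interpolation provides coefficients that detect any given nontrivial
   element of K. *)

(** * Setoid groups *)

Section GroupBasics.
Variables (G : sgroup) (hG : is_group G).

Lemma geq_refl (x : G) : geq x x. Proof. by case: hG. Qed.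
Lemma geq_sym (x y : G) : geq x y -> geq y x. Proof. by case: hG => _ h _ _ _; apply: h. Qed.
Lemma geq_trans (y x z : G) : geq x y -> geq y z -> geq x z.
Proof. by case: hG => _ _ h _ _; apply: h. Qed.
Lemma gmul_congr (x x' y y' : G) : geq x x' -> geq y y' -> geq (gmul x y) (gmul x' y').
Proof. by case: hG => _ _ _ h _; apply: h. Qed.
Lemma ginv_congr (x x' : G) : geq x x' -> geq (ginv x) (ginv x').
Proof. by case: hG => _ _ _ _ [h _ _ _]; apply: h. Qed.
Lemma gmulA (x y z : G) : geq (gmul (gmul x y) z) (gmul x (gmul y z)).
Proof. by case: hG => _ _ _ _ []. Qed.
Lemma gmul1l (x : G) : geq (gmul gone x) x.
Proof. by case: hG => _ _ _ _ []. Qed.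
Lemma gmulVl (x : G) : geq (gmul (ginv x) x) gone.
Proof. by case: hG => _ _ _ _ []. Qed.

Lemma gmulVr (x : G) : geq (gmul x (ginv x)) gone.
Proof.
(* The axioms give left inverses. The element [x x^-1] is idempotent, and multiplying by its left
   inverse shows that an idempotent is 1. *)
have idem : geq (gmul (gmul x (ginv x)) (gmul x (ginv x))) (gmul x (ginv x)).
  apply: geq_trans (gmulA _ _ _) _; apply: gmul_congr (geq_refl _) _.
  apply: geq_trans (geq_sym (gmulA _ _ _)) _.
  exact: geq_trans (gmul_congr (gmulVl _) (geq_refl _)) (gmul1l _).
move: (gmul x _) idem => y idem.
apply: geq_trans (geq_sym (gmul1l _)) _.
apply: geq_trans (gmul_congr (geq_sym (gmulVl y)) (geq_refl _)) _.
apply: geq_trans (gmulA _ _ _) _.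
exact: geq_trans (gmul_congr (geq_refl _) idem) (gmulVl y).
Qed.

Lemma gmul1r (x : G) : geq (gmul x gone) x.
Proof.
apply: geq_trans (gmul_congr (geq_refl _) (geq_sym (gmulVl x))) _.
apply: geq_trans (geq_sym (gmulA _ _ _)) _.
exact: geq_trans (gmul_congr (gmulVr _) (geq_refl _)) (gmul1l _).
Qed.

Lemma ginv_unique (x y : G) : geq (gmul x y) gone -> geq y (ginv x).
Proof.
move=> h; apply: geq_trans (geq_sym (gmul1l _)) _.
apply: geq_trans (gmul_congr (geq_sym (gmulVl x)) (geq_refl _)) _.
apply: geq_trans (gmulA _ _ _) _.
exact: geq_trans (gmul_congr (geq_refl _) h) (gmul1r _).
Qed.

Section Eval.
Variables (A : eqType) (e : A -> G).

Definition letter_eval (p : A * bool) := if p.2 then ginv (e p.1) else e p.1.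
Definition word_eval (u : word A) : G := foldr (fun p => gmul (letter_eval p)) gone u.

Lemma word_eval_cat u v : geq (word_eval (u ++ v)) (gmul (word_eval u) (word_eval v)).
Proof.
elim: u => [|p u IH] /=; first exact: geq_sym (gmul1l _).
exact: geq_trans (gmul_congr (geq_refl _) IH) (geq_sym (gmulA _ _ _)).
Qed.

Lemma letter_evalN p q : p.1 = q.1 -> p.2 != q.2 ->
  geq (gmul (letter_eval p) (letter_eval q)) gone.
Proof.
by case: p q => [a [|]] [b [|]] //= -> _; [apply: gmulVl | apply: gmulVr].
Qed.

Lemma letter_eval_cancel p q x : p.1 = q.1 -> p.2 != q.2 ->
  geq (gmul (letter_eval p) (gmul (letter_eval q) x)) x.
Proof.
move=> h1 h2; apply: geq_trans (geq_sym (gmulA _ _ _)) _.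
exact: geq_trans (gmul_congr (letter_evalN h1 h2) (geq_refl _)) (gmul1l _).
Qed.

Lemma word_eval_freeq u v : freeq u v -> geq (word_eval u) (word_eval v).
Proof.
elim=> [u1 v1 a b|u1|u1 v1 _ IH|u1 v1 w1 _ IH1 _ IH2].
- elim: u1 => [|p u1 IH] /=; last exact: gmul_congr (geq_refl _) IH.
  by apply: letter_eval_cancel => //=; case: b.
- exact: geq_refl.
- exact: geq_sym.
- exact: geq_trans IH1 IH2.
Qed.

Lemma word_eval_inv u : geq (word_eval (winv u)) (ginv (word_eval u)).
Proof.
apply: ginv_unique; apply: geq_trans (geq_sym (word_eval_cat _ _)) _.
rewrite -[gone]/(word_eval [::]); apply: word_eval_freeq.
elim: u => [|p u IH]; first exact: fq_refl.
have -> : (p :: u) ++ winv (p :: u) = [:: p] ++ (u ++ winv u) ++ [:: (p.1, ~~ p.2)].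
  by rewrite /winv /= rev_cons -cats1 catA.
apply: fq_trans; first by apply: freeq_catl; apply: freeq_catr; exact: IH.
by case: p => a b; exact: (fq_red [::] [::] a b).
Qed.
End Eval.

(** * Reflexive decision procedure for group identities *)

Inductive gterm := GV of nat | GM of gterm & gterm | GI of gterm | G1.

Fixpoint gterm_eval (e : nat -> G) t : G :=
  match t with
  | GV n => e n
  | GM a b => gmul (gterm_eval e a) (gterm_eval e b)
  | GI a => ginv (gterm_eval e a)
  | G1 => gone
  end.
End GroupBasics.

Fixpoint gterm_word t : word nat :=
  match t with
  | GV n => [:: (n, false)]
  | GM a b => gterm_word a ++ gterm_word b
  | GI a => winv (gterm_word a)
  | G1 => [::]
  end.

Definition reduce (A : eqType) (u : word A) : word A :=
  foldr (fun p s => if s is q :: s' then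
           if (p.1 == q.1) && (p.2 != q.2) then s' else p :: s
         else [:: p]) [::] u.

Lemma freeq_reduce (A : eqType) (u : word A) : freeq u (reduce u).
Proof.
elim: u => [|[a b] u IH] /=; first exact: fq_refl.
apply: fq_trans; first exact: (freeq_catl [:: (a, b)] IH).
case: (reduce u) => [|[c d] s] /=; first exact: fq_refl.
case: eqP => [<-|_] /=; last exact: fq_refl.
case: eqP => [_|bd]; first exact: fq_refl.
have -> : d = ~~ b by case: b d bd => [] [].
exact: (fq_red [::] s a b).
Qed.

Lemma gterm_eval_word (G : sgroup) (hG : is_group G) (e : nat -> G) t :
  geq (gterm_eval e t) (word_eval e (gterm_word t)).
Proof.
elim: t => [n|a IHa b IHb|a IH|] /=.
- exact/geq_sym/gmul1r.
- exact: geq_trans (gmul_congr hG IHa IHb) (geq_sym hG (word_eval_cat hG _ _ _)).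
- exact: geq_trans (ginv_congr hG IH) (geq_sym hG (word_eval_inv hG _ _)).
- exact: geq_refl.
Qed.

(** Both terms evaluate through words in the free group on the atoms, and reduction does not change
    the element of that group. *)
Lemma gterm_solve (G : sgroup) (hG : is_group G) (e : nat -> G) t1 t2 :
  reduce (gterm_word t1) == reduce (gterm_word t2) ->
  geq (gterm_eval e t1) (gterm_eval e t2).
Proof.
move=> /eqP h.
apply: (geq_trans hG (gterm_eval_word hG e t1)).
apply: (geq_trans hG _ (geq_sym hG (gterm_eval_word hG e t2))).
apply: (word_eval_freeq hG); apply: fq_trans (freeq_reduce _) _.
by rewrite h; apply: fq_sym; apply: freeq_reduce.
Qed.

Ltac add_atom x l :=
  lazymatch l with
  | context [cons x _] => l
  | _ => constr:(cons x l)
  end.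

Ltac group_atoms t l :=
  lazymatch t with
  | gmul ?a ?b => let l := group_atoms a l in group_atoms b l
  | ginv ?a => group_atoms a l
  | gone => l
  | ?x => add_atom x l
  end.

Ltac atom_index x l :=
  lazymatch l with
  | cons x _ => constr:(0)
  | cons _ ?l' => let n := atom_index x l' in constr:(S n)
  end.

Ltac group_reify t l :=
  lazymatch t with
  | gmul ?a ?b =>
      let a := group_reify a l in let b := group_reify b l in constr:(GM a b)
  | ginv ?a => let a := group_reify a l in constr:(GI a)
  | gone => constr:(G1)
  | ?x => let n := atom_index x l in constr:(GV n)
  end.

(* Decides identities of the theory of groups, by free reduction. *)
Ltac group_id hG :=
  rewrite /comm /conj;
  lazymatch goal with
  | |- @geq ?G ?x ?y =>
      let l := group_atoms x (@nil (car G)) in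
      let l := group_atoms y l in
      let t1 := group_reify x l in
      let t2 := group_reify y l in
      exact (@gterm_solve G hG (nth (@gone G) l) t1 t2 isT)
  end.

(** * Ascending chain condition above a term of the lower central series *)

(** The least positive integer d met anywhere in the chain lies in some [S n]. It divides every
    element of every member, since a nonzero remainder modulo d would be a smaller positive element
    of a later member. *)
Lemma int_chain_stabilizes (S : nat -> int -> Prop) :
  (forall n, S n 0%R) -> (forall n x y, S n x -> S n y -> S n (x - y)%R) ->
  (forall n x, S n x -> S n.+1 x) ->
  exists n, forall m x, S m x -> S n x.
Proof.
move=> S0 SB Sincr.
have Smono n m x : n <= m -> S n x -> S m x.
  by move=> /subnKC <- hx; elim: (m - n) => [|d IH]; rewrite ?addn0 ?addnS //; apply: Sincr.
have SN n x : S n x -> S n (- x)%R by move=> hx; rewrite -sub0r; apply: SB.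
have SD n x y : S n x -> S n y -> S n (x + y)%R.
  by move=> hx hy; rewrite -[y]opprK; apply: SB => //; apply: SN.
have SM n x (q : int) : S n x -> S n (q * x)%R.
  have SMn (k : nat) : S n x -> S n (k%:Z * x)%R.
    move=> hx; elim: k => [|k IH]; first by rewrite mul0r.
    by rewrite intS mulrDl mul1r; apply: SD.
  case: q => k hx; first exact: SMn.
  by rewrite NegzE mulNr; apply: SN; apply: SMn.
case: (classic (exists d : nat, 0 < d /\ exists n, S n (Posz d))); last first.
  move=> no; exists 0 => m x hx.
  suff -> : x = 0%R by [].
  case: (eqVneq x 0%R) => // x0; case: no; exists `|x|%N; split; first lia.
  exists m; case: (ltP x 0%R) => hx0.
    have -> : Posz `|x|%N = (- x)%R by lia.
    exact: SN.
  by have -> : Posz `|x|%N = x by lia.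
move=> [d0 [d0_gt0 hd0]].
have [d [d_gt0 [n hn] dmin]] : exists d : nat, [/\ 0 < d, exists n, S n (Posz d) &
    forall e : nat, 0 < e -> forall n, S n (Posz e) -> d <= e].
  elim/ltn_ind: d0 d0_gt0 hd0 => d IH d_gt0 hd.
  case: (classic (exists e : nat, e < d /\ 0 < e /\ exists n, S n (Posz e))).
    by move=> [e [ed [e0 he]]]; exact: (IH e ed e0 he).
  move=> no; exists d; split=> // e e0 n he.
  by rewrite leqNgt; apply/negP => ed; apply: no; exists e; split=> //; split=> //; exists n.
exists n => m x hx.
rewrite (divz_eq x (Posz d)).
have r0 : (0 <= (x %% (Posz d))%Z)%R by apply: modz_ge0; lia.
have rd : ((x %% (Posz d))%Z < (Posz d))%R by apply: ltz_pmod; lia.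
case: (eqVneq (x %% (Posz d))%Z 0%R) => [->|rne].
  by rewrite addr0; apply: SM.
have hr : S (maxn m n) (x %% (Posz d))%Z.
  rewrite /modz; apply: SB; first exact: Smono (leq_maxl _ _) hx.
  by apply: SM; exact: Smono (leq_maxr _ _) hn.
have := dmin `|(x %% (Posz d))%Z|%N _ (maxn m n).
have -> : Posz `|(x %% (Posz d))%Z|%N = (x %% (Posz d))%Z by lia.
move=> /(_ _ hr); lia.
Qed.

Section Subgroups.
Variables (G : sgroup) (hG : is_group G).

Definition is_subgroup (P : G -> Prop) : Prop :=
  [/\ P gone, forall x y, P x -> P y -> P (gmul x y), forall x, P x -> P (ginv x)
    & forall x y, geq x y -> P x -> P y].

Lemma gen_subgroup (S : G -> Prop) : is_subgroup (gen S).
Proof.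
split; [exact: gen_one|exact: gen_mul|exact: gen_inv|exact: gen_eq].
Qed.

Lemma gen_min (S P : G -> Prop) : is_subgroup P -> (forall x, S x -> P x) ->
  forall x, gen S x -> P x.
Proof.
move=> [P1 PM PV PE] SP x; elim=> {x}; [exact: SP|exact: P1|..].
- by move=> x y _ hx _ hy; apply: PM.
- by move=> x _ hx; apply: PV.
- by move=> x y xy _ hx; apply: PE xy hx.
Qed.

Lemma gen_sub (S S' : G -> Prop) : (forall x, S x -> gen S' x) ->
  forall x, gen S x -> gen S' x.
Proof. by apply: gen_min; apply: gen_subgroup. Qed.

Lemma lcs_subgroup k : is_subgroup (lcs G k).
Proof. by case: k => [|k]; [split | apply: gen_subgroup]. Qed.

Lemma lcs_conj k x g : lcs G k x -> lcs G k (conj x g).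
Proof.
elim: k x g => [|k IH] x g //=; elim=> {x}.
- move=> _ [x [y [_ [hy ->]]]].
  apply: (@gen_eq _ _ (comm (conj x g) (conj y g))); first by group_id hG.
  by apply: gen_in; exists (conj x g), (conj y g); split=> //; split=> //; exact: IH.
- by apply: (@gen_eq _ _ gone); [group_id hG | apply: gen_one].
- move=> x y _ hx _ hy; apply: (@gen_eq _ _ (gmul (conj x g) (conj y g))).
    by group_id hG.
  exact: gen_mul.
- move=> x _ hx; apply: (@gen_eq _ _ (ginv (conj x g))); first by group_id hG.
  exact: gen_inv.
- move=> x y xy _ hx; apply: gen_eq hx.
  by apply: gmul_congr => //; [apply: gmul_congr => //|]; apply: geq_refl.
Qed.

Lemma lcs_succ_sub k x : lcs G k.+1 x -> lcs G k x.
Proof.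
have [h1 hM hV hE] := lcs_subgroup k.
apply: gen_min; first exact: lcs_subgroup.
move=> _ [y [z [_ [hz ->]]]].
apply: (hE (gmul (conj (ginv z) y) z)); first by group_id hG.
by apply: hM => //; apply: lcs_conj; apply: hV.
Qed.

Lemma lcs_comm k x g : lcs G k x -> lcs G k.+1 (comm x g).
Proof.
move=> hx; apply: (@gen_eq _ _ (ginv (comm g x))); first by group_id hG.
by apply: gen_inv; apply: gen_in; exists g, x.
Qed.

Definition zpow (c : G) (m : int) : G :=
  match m with
  | Posz n => iter n (gmul c) gone
  | Negz n => iter n.+1 (gmul (ginv c)) gone
  end.

Lemma zpowS c m : geq (zpow c (m + 1)) (gmul c (zpow c m)).
Proof.
case: m => [n|[|n]]; first by rewrite -PoszD addn1; apply: geq_refl.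
  by rewrite /zpow /=; group_id hG.
have -> : (Negz n.+1 + 1)%R = Negz n by lia.
by rewrite /zpow [iter n.+2 _ _]iterS; move: (iter n.+1 _ _) => x; group_id hG.
Qed.

Lemma zpowP c m : geq (zpow c (m - 1)) (gmul (ginv c) (zpow c m)).
Proof.
have h := zpowS c (m - 1); rewrite subrK in h.
apply: (geq_trans hG _ (gmul_congr hG (geq_refl hG _) (geq_sym hG h))).
group_id hG.
Qed.

Lemma zpowD c m n : geq (zpow c (m + n)) (gmul (zpow c m) (zpow c n)).
Proof.
elim/int_ind: m => [|m IH|m IH].
- by rewrite add0r /=; apply: geq_sym => //; apply: gmul1l.
- have -> : (m.+1%:Z + n = (m%:Z + n) + 1)%R by lia.
  apply: (geq_trans hG (zpowS _ _)).
  apply: (geq_trans hG (gmul_congr hG (geq_refl hG c) IH)).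
  by rewrite [zpow c m.+1]/zpow iterS -/(zpow c m); group_id hG.
- have -> : (- (m.+1)%:Z + n = (- m%:Z + n) - 1)%R by lia.
  have -> : (- (m.+1)%:Z = - m%:Z - 1)%R by lia.
  apply: (geq_trans hG (zpowP _ _)).
  apply: (geq_trans hG (gmul_congr hG (geq_refl hG (ginv c)) IH)).
  apply: (geq_trans hG (geq_sym hG (gmulA hG _ _ _))).
  exact: (gmul_congr hG (geq_sym hG (zpowP _ _)) (geq_refl hG _)).
Qed.

End Subgroups.

Section Noetherian.
Variables (G : sgroup) (hG : is_group G).

Lemma zpowN (c : G) m : geq (zpow c (- m)) (ginv (zpow c m)).
Proof.
apply: (ginv_unique hG); apply: (geq_trans hG (geq_sym hG (zpowD hG _ _ _))).
by rewrite subrr; apply: geq_refl.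
Qed.

Definition adjoin (Q : G -> Prop) (cs : seq G) : G -> Prop :=
  gen (fun x => Q x \/ List.In x cs).

Lemma adjoin1_zpow (Q : G -> Prop) c :
  is_subgroup Q -> (forall x g, Q x -> Q (conj x g)) ->
  forall x, adjoin Q [:: c] x -> exists q m, Q q /\ geq x (gmul q (zpow c m)).
Proof.
move=> [Q1 QM QV QE] QJ; apply: gen_min.
  split.
  - by exists gone, 0%R; split=> //=; group_id hG.
  - move=> x y [p [m [hp ex]]] [q [n [hq ey]]].
    exists (gmul p (conj q (ginv (zpow c m)))), (m + n)%R.
    split; first by apply: QM => //; apply: QJ.
    apply: (geq_trans hG (gmul_congr hG ex ey)).
    apply: (geq_trans hG _ (gmul_congr hG (geq_refl hG _) (geq_sym hG (zpowD hG _ _ _)))).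
    by group_id hG.
  - move=> x [p [m [hp ex]]].
    exists (conj (ginv p) (zpow c m)), (- m)%R; split; first by apply: QJ; apply: QV.
    apply: (geq_trans hG (ginv_congr hG ex)).
    apply: (geq_trans hG _ (gmul_congr hG (geq_refl hG _) (geq_sym hG (zpowN _ _)))).
    by group_id hG.
  - move=> x y xy [p [m [hp ex]]]; exists p, m; split=> //.
    exact: geq_trans (geq_sym hG xy) ex.
move=> x [hx|[<-|[]]]; first by exists x, 0%R; split=> //=; group_id hG.
by exists gone, 1%R; split=> //=; group_id hG.
Qed.

(** The chain is compared on Q only, so that the chain condition can be carried layer by layer from
    a deep term of the lower central series up to G. *)
Definition stationary (K : nat -> G -> Prop) (Q : G -> Prop) : Prop :=
  exists n, forall m x, Q x -> K m x -> K n x.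

Variable K : nat -> G -> Prop.
Hypothesis K_subgroup : forall n, is_subgroup (K n).
Hypothesis K_incr : forall n x, K n x -> K n.+1 x.

Lemma K_mono n m x : n <= m -> K n x -> K m x.
Proof.
by move=> /subnKC <- hx; elim: (m - n) => [|d IH]; rewrite ?addn0 ?addnS //; apply: K_incr.
Qed.

(** Extension by a cyclic quotient: the chain stabilizes on Q and, separately, on the exponents of c
    modulo Q. An element [q c^z] of the chain is then divided by some [q' c^z] of a fixed member,
    which leaves an element of Q. *)
Lemma stationary_adjoin1 (Q : G -> Prop) c :
  is_subgroup Q -> (forall x g, Q x -> Q (conj x g)) ->
  stationary K Q -> stationary K (adjoin Q [:: c]).
Proof.
move=> hQ QJ [n1 hn1].
have [Q1 QM QV QE] := hQ.
(* The exponents of c attained by [K n] modulo Q; they form an ascending chain of subgroups of Z. *)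
pose S n m := exists2 q, Q q & K n (gmul q (zpow c m)).
have [n2 hn2] : exists n, forall m x, S m x -> S n x.
  apply: int_chain_stabilizes => n.
  - have [k1 _ _ kE] := K_subgroup n.
    by exists gone => //; apply: kE k1; rewrite /=; group_id hG.
  - have [_ kM kV kE] := K_subgroup n.
    move=> x y [p hp kp] [q hq kq].
    set Z := zpow c (x - y).
    have hZ : geq Z (gmul (zpow c x) (ginv (zpow c y))).
      exact: geq_trans (zpowD hG c x (- y)) (gmul_congr hG (geq_refl hG _) (zpowN c y)).
    exists (gmul p (conj (ginv q) (ginv Z))).
      by apply: QM => //; apply: QJ; apply: QV.
    apply: (kE (gmul (gmul p (zpow c x)) (ginv (gmul q (zpow c y))))); last first.
      by apply: kM => //; apply: kV.
    apply: (geq_trans hG (y := gmul (gmul p (gmul (zpow c x) (ginv (zpow c y)))) (ginv q))).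
      by group_id hG.
    apply: (geq_trans hG (y := gmul (gmul p Z) (ginv q))); last by rewrite -/Z; group_id hG.
    apply: gmul_congr => //; last exact: geq_refl.
    by apply: gmul_congr => //; [exact: geq_refl | apply: geq_sym].
  - by move=> x [q hq kq]; exists q => //; apply: K_incr.
exists (maxn n1 n2) => m x hx kx.
have [q [z [hq ex]]] := adjoin1_zpow hQ QJ hx.
have [_ kM kV kE] := K_subgroup (maxn n1 n2).
have [q' hq' kq'] : S n2 z.
  apply: (hn2 m); exists q => //.
  by have [_ _ _ kE'] := K_subgroup m; apply: kE' kx.
apply: (kE (gmul (gmul q (ginv q')) (gmul q' (zpow c z)))).
  by apply: (geq_trans hG _ (geq_sym hG ex)); group_id hG.
apply: kM; last exact: K_mono (leq_maxr _ _) kq'.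
apply: K_mono (leq_maxl n1 n2) _.
apply: (hn1 (maxn m n2)); first by apply: QM => //; apply: QV.
have [_ lM lV lE] := K_subgroup (maxn m n2).
apply: (lE (gmul x (ginv (gmul q' (zpow c z))))).
  apply: (geq_trans hG (gmul_congr hG ex (geq_refl hG _))); group_id hG.
apply: lM; first exact: K_mono (leq_maxl _ _) kx.
by apply: lV; apply: K_mono (leq_maxr _ _) kq'.
Qed.

Section Layer.
Variable k : nat.

(** Every subgroup between two consecutive terms is normal: x^g = x [x, g], and [x, g] lies in the
    lower term. *)
Lemma adjoin_lcs_normal cs : (forall c, List.In c cs -> lcs G k c) ->
  forall x g, adjoin (lcs G k.+1) cs x -> adjoin (lcs G k.+1) cs (conj x g).
Proof.
move=> hcs x g hx.
have lx : lcs G k x.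
  apply: gen_min hx; first exact: lcs_subgroup.
  by move=> y [/(lcs_succ_sub hG)|/hcs].
apply: (@gen_eq _ _ (gmul x (comm x g))); first by group_id hG.
by apply: gen_mul => //; apply: gen_in; left; apply: lcs_comm.
Qed.

Lemma stationary_adjoin cs : (forall c, List.In c cs -> lcs G k c) ->
  stationary K (lcs G k.+1) -> stationary K (adjoin (lcs G k.+1) cs).
Proof.
move=> hcs h0; elim: cs hcs => [|c cs IH] hcs.
  case: h0 => n hn; exists n => m x hx; apply: hn; apply: gen_min hx.
    exact: lcs_subgroup.
  by move=> y [|[]].
have hcs' c' : List.In c' cs -> lcs G k c' by move=> hc; apply: hcs; right.
have [n hn] := stationary_adjoin1 c (gen_subgroup _) (adjoin_lcs_normal hcs') (IH hcs').
exists n => m x hx; apply: hn; apply: gen_sub hx => y [hy|[<-|hy]].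
- by apply: gen_in; left; apply: gen_in; left.
- by apply: gen_in; right; left.
- by apply: gen_in; left; apply: gen_in; right.
Qed.
End Layer.

Variable gens : seq G.
Hypothesis gensP : forall x, gen (fun y => List.In y gens) x.

(** Modulo the next term, a layer is generated by the commutators of generators of G with generators
    of the previous layer. The identities expanding [y1 y2, z] and [y, z1 z2] involve conjugates,
    which stay in P because P is normal. *)
Lemma lcs_layer_fg k : exists cs, (forall c, List.In c cs -> lcs G k c) /\ forall x, lcs G k x -> adjoin (lcs G k.+1) cs x.
Proof.
elim: k => [|k [cs [hcs genk]]].
  exists gens; split=> // x _; apply: gen_sub (gensP x) => y hy.
  by apply: gen_in; right.
pose cs' := List.map (fun p => comm p.1 p.2) (List.list_prod gens cs).
have hcs' c : List.In c cs' -> lcs G k.+1 c.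
  move=> /List.in_map_iff [[a y] [<- /List.in_prod_iff [_ hy]]] /=.
  by apply: gen_in; exists a, y; split=> //; split=> //; apply: hcs.
exists cs'; split=> // x.
set P := adjoin _ _.
have hP : is_subgroup P := gen_subgroup _.
have [P1 PM PV PE] := hP.
have PJ : forall x g, P x -> P (conj x g) := adjoin_lcs_normal hcs'.
suff main y z : lcs G k z -> P (comm y z).
  by apply: gen_min => // _ [y [z [_ [hz ->]]]]; apply: main.
have hy := gensP y; elim: hy z => {y}.
- move=> a ha z /genk; elim=> {z}.
  + move=> z [hz|hz]; first by apply: gen_in; left; apply: gen_in; exists a, z.
    apply: gen_in; right; apply/List.in_map_iff; exists (a, z); split=> //.
    exact/List.in_prod.
  + by apply: PE P1; group_id hG.
  + move=> z1 z2 _ h1 _ h2.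
    apply: (PE (gmul (comm a z2) (conj (comm a z1) z2))); first by group_id hG.
    by apply: PM => //; apply: PJ.
  + move=> z _ hz; apply: (PE (conj (ginv (comm a z)) (ginv z))); first by group_id hG.
    by apply: PJ; apply: PV.
  + move=> z1 z2 e _ hz; apply: PE hz; have r := geq_refl hG.
    by do !apply: gmul_congr => //; apply: ginv_congr.
- by move=> z _; apply: PE P1; group_id hG.
- move=> y1 y2 _ h1 _ h2 z hz.
  apply: (PE (gmul (conj (comm y1 z) y2) (comm y2 z))); first by group_id hG.
  by apply: PM; [apply: PJ; apply: h1 | apply: h2].
- move=> y _ h z hz; apply: (PE (conj (ginv (comm y z)) (ginv y))); first by group_id hG.
  by apply: PJ; apply: PV; apply: h.
- move=> y1 y2 e _ h z hz; apply: PE (h z hz); have r := geq_refl hG.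
  by do !apply: gmul_congr => //; apply: ginv_congr.
Qed.

Lemma stationary_lcs k j : stationary K (lcs G k) -> stationary K (lcs G (k - j)).
Proof.
move=> hk; elim: j => [|j IH]; first by rewrite subn0.
(* Subtraction truncates: once j reaches k, the term is [lcs G 0] and stays there. *)
have [le_kj|lt_jk] := leqP k j; first by move: IH; rewrite subnS; have -> : k - j = 0 by lia.
have [cs [hcs hgen]] := lcs_layer_fg (k - j.+1).
rewrite subnSK // in hgen hcs.
have := stationary_adjoin hcs; rewrite subnSK // => /(_ IH) [n hn].
by exists n => m x /hgen; apply: hn.
Qed.

(** The chain is constant on [lcs G k], which [K 0] already contains; finitely many layers lead from
    there to [lcs G 0], the whole group. *)
Lemma chain_above_lcs_stabilizes k : (forall x, lcs G k x -> K 0 x) ->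
  exists n, forall x, K n.+1 x -> K n x.
Proof.
move=> hk; have [] := @stationary_lcs k k.
  by exists 0 => m x /hk.
by rewrite subnn => n hn; exists n => x; apply: hn.
Qed.

End Noetherian.

(** * Isomorphisms and the Hopf property *)

Lemma quot_group (G : sgroup) (hG : is_group G) (M : G -> Prop) :
  is_normal M -> is_group (quot M).
Proof.
move=> [M1 MM MV ME MJ]; split; last split; rewrite /=.
- by move=> x; apply: ME M1; group_id hG.
- by move=> x y h; apply: ME (MV _ h); group_id hG.
- by move=> x y z h1 h2; apply: ME (MM _ _ h1 h2); group_id hG.
- by move=> x x' y y' hx hy; apply: ME (MM _ _ (MJ _ y hx) hy); group_id hG.
- by move=> x x' h; apply: ME (MJ _ (ginv x') (MV _ h)); group_id hG.
- by move=> x y z; apply: ME M1; group_id hG.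
- by move=> x; apply: ME M1; group_id hG.
- by move=> x; apply: ME M1; group_id hG.
Qed.

Lemma lcs_normal (G : sgroup) (hG : is_group G) k : is_normal (lcs G k).
Proof.
have [h1 h2 h3 h4] := lcs_subgroup G k; split=> //.
by move=> x g; apply: lcs_conj.
Qed.

Section Morphisms.
Variables (G H : sgroup) (hG : is_group G) (hH : is_group H) (f : G -> H).
Hypothesis fE : forall x y, geq x y -> geq (f x) (f y).
Hypothesis fM : forall x y, geq (f (gmul x y)) (gmul (f x) (f y)).

Lemma hom_one : geq (f gone) gone.
Proof.
have h : geq (gmul (f gone) (f gone)) (f gone).
  apply: (geq_trans hH (geq_sym hH (fM _ _))).
  by apply: fE; apply: gmul1l.
move: (f gone) h => x h.
apply: (geq_trans hH (y := gmul (ginv x) (gmul x x))); first by group_id hH.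
exact: geq_trans (gmul_congr hH (geq_refl hH _) h) (gmulVl hH _).
Qed.

Lemma hom_inv x : geq (f (ginv x)) (ginv (f x)).
Proof.
apply: (ginv_unique hH); apply: (geq_trans hH (geq_sym hH (fM _ _))).
by apply: (geq_trans hH _ hom_one); apply: fE; apply: gmulVr.
Qed.

Lemma hom_comm x y : geq (f (comm x y)) (comm (f x) (f y)).
Proof.
rewrite /comm; apply: (geq_trans hH (fM _ _)); apply: gmul_congr => //.
apply: (geq_trans hH (fM _ _)); apply: gmul_congr => //; exact: hom_inv.
Qed.

Lemma hom_lcs k x : lcs G k x -> lcs H k (f x).
Proof.
elim: k x => [|k IH] x //=.
have [h1 hM hV hE] := lcs_subgroup H k.+1.
apply: (gen_min (P := fun y => lcs H k.+1 (f y))).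
  split.
  - by apply: hE h1; apply: geq_sym => //; apply: hom_one.
  - by move=> y z hy hz; apply: (hE _ _ (geq_sym hH (fM _ _))); apply: hM.
  - by move=> y hy; apply: (hE _ _ (geq_sym hH (hom_inv _))); apply: hV.
  - by move=> y z yz; apply: hE; apply: fE.
move=> _ [y [z [_ [hz ->]]]]; apply: (hE _ _ (geq_sym hH (hom_comm _ _))).
by apply: gen_in; exists (f y), (f z); split=> //; split=> //; apply: IH.
Qed.
End Morphisms.

Section Isomorphisms.

(** Surjectivity is only an existence statement, so preimages are chosen; injectivity of f makes the
    choice compatible with the equality relations. *)
Lemma iso_inverse (G H : sgroup) (hH : is_group H) (f : G -> H) :
  is_iso f -> exists2 f', is_iso f' & forall x, geq (f' (f x)) x.
Proof.
move=> [fE fM fI fS].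
pose f' y := proj1_sig (constructive_indefinite_description _ (fS y)).
have f'K y : geq (f (f' y)) y := proj2_sig (constructive_indefinite_description _ (fS y)).
exists f'; last by move=> x; apply: fI.
split.
- move=> x y xy; apply: fI; apply: (geq_trans hH (f'K x)).
  exact: geq_trans xy (geq_sym hH (f'K y)).
- move=> x y; apply: fI; apply: (geq_trans hH (f'K _)).
  apply: (geq_trans hH _ (geq_sym hH (fM _ _))).
  by apply: gmul_congr => //; apply: geq_sym.
- move=> x y /fE h; apply: (geq_trans hH (geq_sym hH (f'K x))).
  exact: geq_trans h (f'K y).
- by move=> x; exists (f x); apply: fI.
Qed.

Lemma isomorphic_sym (G H : sgroup) (hH : is_group H) :
  isomorphic G H -> isomorphic H G.
Proof. by move=> [f /(iso_inverse hH)[f' hf' _]]; exists f'. Qed.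

Lemma isomorphic_trans (G H K : sgroup) (hK : is_group K) :
  isomorphic G H -> isomorphic H K -> isomorphic G K.
Proof.
move=> [f [fE fM fI fS]] [h [hE hM hI hS]]; exists (h \o f); split=> /=.
- by move=> x y /fE/hE.
- by move=> x y; apply: (geq_trans hK _ (hM _ _)); apply: hE.
- by move=> x y /hI/fI.
- move=> z; have [y hy] := hS z; have [x hx] := fS y; exists x.
  exact: geq_trans (hE _ _ hx) hy.
Qed.

Lemma iso_quot (G H : sgroup) (hG : is_group G) (hH : is_group H) (f : G -> H)
    (P : G -> Prop) (Q : H -> Prop) :
  is_normal P -> is_normal Q -> is_iso f -> (forall x, P x <-> Q (f x)) ->
  @is_iso (quot P) (quot Q) f.
Proof.
move=> hP hQ [fE fM fI fS] PQ.
have [Q1 QM QV QE QJ] := hQ.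
have e x y : geq (f (gmul (ginv x) y)) (gmul (ginv (f x)) (f y)).
  apply: (geq_trans hH (fM _ _)); apply: gmul_congr => //; last exact: geq_refl.
  exact: hom_inv.
have geqQ (x y : H) : geq x y -> @geq (quot Q) x y.
  move=> xy; apply: QE Q1; apply: (geq_trans hH (y := gmul (ginv x) x)).
    by group_id hH.
  exact: (gmul_congr hH (geq_refl hH _) xy).
split.
- by move=> x y /PQ h; apply: QE h.
- by move=> x y; apply: geqQ; apply: fM.
- by move=> x y h; apply/PQ; apply: QE h; apply: geq_sym => //; apply: e.
- by move=> y; have [x hx] := fS y; exists x; apply: geqQ.
Qed.

Lemma iso_lcs (G H : sgroup) (hG : is_group G) (hH : is_group H) (f : G -> H) k :
  is_iso f -> forall x, lcs G k x <-> lcs H k (f x).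
Proof.
move=> hf x; have [fE fM _ _] := hf; split; first exact: hom_lcs.
have [f' [f'E f'M _ _] f'K] := iso_inverse hH hf.
move=> /(hom_lcs hH hG f'E f'M); have [_ _ _ hE] := lcs_subgroup G k.
exact: hE.
Qed.

Lemma isomorphic_quot_gamma (G H : sgroup) (hG : is_group G) (hH : is_group H) k :
  isomorphic G H -> isomorphic (quot (gamma G k)) (quot (gamma H k)).
Proof.
move=> [f hf]; exists f; apply: iso_quot => //; try exact: lcs_normal.
exact: iso_lcs.
Qed.

Lemma gimage_normal (G H : sgroup) (hG : is_group G) (hH : is_group H) (f : G -> H)
    (P : G -> Prop) : is_iso f -> is_normal P -> is_normal (gimage f P).
Proof.
move=> [fE fM fI fS] [P1 PM PV PE PJ]; split.
- by exists gone; split=> //; apply: hom_one.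
- move=> x y [u [hu eu]] [v [hv ev]]; exists (gmul u v); split; first exact: PM.
  exact: geq_trans (fM _ _) (gmul_congr hH eu ev).
- move=> x [u [hu eu]]; exists (ginv u); split; first exact: PV.
  exact: geq_trans (hom_inv hG hH fE fM _) (ginv_congr hH eu).
- by move=> x y xy [u [hu eu]]; exists u; split=> //; exact: geq_trans eu xy.
- move=> x g [u [hu eu]]; have [v ev] := fS g.
  exists (conj u v); split; first exact: PJ.
  apply: (geq_trans hH (fM _ _)); apply: gmul_congr => //.
  apply: (geq_trans hH (fM _ _)); apply: gmul_congr => //.
  exact: geq_trans (hom_inv hG hH fE fM _) (ginv_congr hH ev).
Qed.

Lemma gimage_iff (G H : sgroup) (f : G -> H) (P : G -> Prop) :
  is_iso f -> is_normal P -> (forall x : H, geq x x) ->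
  forall x, P x <-> gimage f P (f x).
Proof.
move=> [fE fM fI fS] [P1 PM PV PE PJ] hr x; split; first by exists x.
by move=> [u [hu /fI e]]; apply: PE hu.
Qed.
End Isomorphisms.

(* The preimages of 1 under the iterates of [f^-1 \o pi], where [pi] is the
   projection [G/C1 -> G/C2], form the ascending chain K. *)
Lemma nilpotent_hopfian (G : sgroup) (hG : is_group G) (gens : seq G)
    (gensP : forall x, gen (fun y => List.In y gens) x) k (C1 C2 : G -> Prop) :
  is_normal C1 -> is_normal C2 -> (forall x, lcs G k x -> C1 x) ->
  (forall x, C1 x -> C2 x) -> isomorphic (quot C1) (quot C2) ->
  forall x, C2 x -> C1 x.
Proof.
move=> hC1 hC2 lcsC1 C12 [f [fE fM fI fS]].
have hQ1 := quot_group hG hC1; have hQ2 := quot_group hG hC2.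
have [A1 AM AV AE AJ] := hC1; have [B1 BM BV BE BJ] := hC2.
have geqQ2 (x y : G) : geq x y -> @geq (quot C2) x y.
  move=> xy; apply: BE B1; apply: (geq_trans hG (y := gmul (ginv x) x)).
    by group_id hG.
  exact: (gmul_congr hG (geq_refl hG _) ltac:(eassumption)).
pose K := fix K n x := if n is n'.+1 then exists2 y, K n' y & @geq (quot C2) (f y) x
                       else C1 x.
have Ksub n : is_subgroup (K n).
  elim: n => [|n [k1 kM kV kE]]; first by split.
  split=> /=.
  - by exists gone => //; exact: (hom_one hQ1 hQ2 fE fM).
  - move=> x y [u hu eu] [v hv ev]; exists (gmul u v); first exact: kM.
    exact: (geq_trans hQ2 (fM u v) (gmul_congr hQ2 eu ev)).
  - move=> x [u hu eu]; exists (ginv u); first exact: kV.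
    exact: (geq_trans hQ2 (hom_inv hQ1 hQ2 fE fM u) (ginv_congr hQ2 eu)).
  - move=> x y xy [u hu eu]; exists u => //.
    exact: (geq_trans hQ2 eu (geqQ2 _ _ xy)).
have Kincr n x : K n x -> K n.+1 x.
  elim: n x => [|n IH] x /=.
    move=> hx; exists gone => //; apply: (geq_trans hQ2 (hom_one hQ1 hQ2 fE fM)).
    by apply: BE (C12 _ hx); group_id hG.
  by move=> [y hy e]; exists y => //; apply: IH.
have [n hn] := chain_above_lcs_stabilizes hG Ksub Kincr gensP lcsC1.
have C1K m x : C1 x -> K m x by elim: m x => [|m IH] x // hx; apply: Kincr; apply: IH.
(* Stationarity descends to the start of the chain: for x in [K m.+1], f x lies in [K m.+2], hence
   in [K m.+1], so by injectivity x agrees modulo C1 with an element of [K m]. *)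
have down m : (forall x, K m.+2 x -> K m.+1 x) -> forall x, K m.+1 x -> K m x.
  move=> h x hx.
  have [|y hy e] := h (f x); first by exists x => //; exact: (geq_refl hQ2).
  have [_ kM _ kE] := Ksub m.
  apply: (kE (gmul y (gmul (ginv y) x))); first by group_id hG.
  by apply: kM => //; apply: C1K; exact: fI e.
have K10 x : K 1 x -> K 0 x by elim: n hn x => [|n IH] // /down.
(* [K 1] contains C2, because f 1 = 1 modulo C2, and [K 0] is C1. *)
move=> x hx; apply: K10; exists gone => //.
apply: (geq_trans hQ2 (hom_one hQ1 hQ2 fE fM)).
by apply: BE hx; group_id hG.
Qed.

Lemma lcs_quot_mono (G : sgroup) (M1 M2 : G -> Prop) k :
  (forall x, M1 x -> M2 x) -> forall x, lcs (quot M1) k x -> lcs (quot M2) k x.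
Proof.
move=> h; elim: k => [|k IH] x //=; apply: gen_min.
  have [h1 hM hV hE] := lcs_subgroup (quot M2) k.+1; split=> //.
  by move=> y z yz; apply: hE; apply: h.
move=> _ [y [z [_ [hz ->]]]]; apply: gen_in; exists y, z.
by split=> //; split=> //; apply: IH.
Qed.

Lemma lcs_sub_quot (G : sgroup) (hG : is_group G) (M : G -> Prop) k : is_normal M ->
  forall x, lcs G k x -> lcs (quot M) k x.
Proof.
move=> [M1 MM MV ME MJ]; elim: k => [|k IH] x //=; apply: gen_min.
  have [h1 hM hV hE] := lcs_subgroup (quot M) k.+1; split=> //.
  move=> y z yz; apply: hE; apply: ME M1.
  apply: (geq_trans hG (y := gmul (ginv y) y)); first by group_id hG.
  exact: (gmul_congr hG (geq_refl hG _) ltac:(eassumption)).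
move=> _ [y [z [_ [hz ->]]]]; apply: gen_in; exists y, z.
by split=> //; split=> //; apply: IH.
Qed.

Lemma quot_lcs_normal (G : sgroup) (hG : is_group G) (M : G -> Prop) k : is_normal M ->
  @is_normal G (lcs (quot M) k).
Proof.
move=> hM; have hQ := quot_group hG hM.
have [h1 h2 h3 h4 h5] := lcs_normal hQ k; split=> //.
have [M1 MM MV ME MJ] := hM.
move=> x y xy; apply: h4; apply: ME M1.
apply: (geq_trans hG (y := gmul (ginv x) x)); first by group_id hG.
exact: (gmul_congr hG (geq_refl hG _) ltac:(eassumption)).
Qed.

(** The Hopf property is applied to the preimages in G of [gamma k] of G/M1 and G/M2; as a quotient
    keeps its carrier, each preimage is the same predicate. The second preimage contains M2. *)
Lemma same_nilpotent_quotients (G : sgroup) (hG : is_group G) (gens : seq G)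
    (gensP : forall x, gen (fun y => List.In y gens) x) (M1 M2 : G -> Prop) k :
  is_normal M1 -> is_normal M2 -> (forall x, M1 x -> M2 x) ->
  isomorphic (quot (gamma (quot M1) k)) (quot (gamma (quot M2) k)) ->
  forall x, M2 x -> gamma (quot M1) k x.
Proof.
move=> hM1 hM2 M12 iso x hx.
apply: (nilpotent_hopfian hG gensP (k := k.-1) (quot_lcs_normal hG _ hM1)
          (quot_lcs_normal hG k.-1 hM2)) => //.
- exact: lcs_sub_quot.
- exact: lcs_quot_mono.
- have [h1 _ _ hE] := lcs_subgroup (quot M2) k.-1.
  apply: hE h1; have [_ _ _ ME _] := hM2.
  by apply: ME hx; group_id hG.
Qed.

(** * The action of the surface group *)

Section MagnusAction.
Variables (L : eqType) (phi : L -> nat -> int).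
Local Open Scope ring_scope.

Definition magnus_fwd l (v : nat -> int) i : int :=
  if i is i'.+1 then v i + phi l i' * v i' else v i.

(** The inverse of [magnus_fwd l], by forward substitution along the index. *)
Fixpoint magnus_bwd l (v : nat -> int) i : int :=
  if i is i'.+1 then v i - phi l i' * magnus_bwd l v i' else v i.

Definition magnus_letter (p : L * bool) := if p.2 then magnus_bwd p.1 else magnus_fwd p.1.
Definition magnus (u : word L) (v : nat -> int) := foldr magnus_letter v u.

Lemma magnus_cat u u' v : magnus (u ++ u') v = magnus u (magnus u' v).
Proof. exact: foldr_cat. Qed.

Lemma magnus_letterK l b v : magnus_letter (l, b) (magnus_letter (l, ~~ b) v) = v.
Proof.
apply: functional_extensionality => i; case: b; rewrite /magnus_letter /=.
  by elim: i => [|i IH] //=; rewrite IH addrK.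
by case: i => [|i] //=; rewrite subrK.
Qed.

Lemma magnus_freeq u u' : freeq u u' -> magnus u =1 magnus u'.
Proof.
elim=> [u1 v1 a b|//|u1 v1 _ IH|u1 v1 w1 _ IH1 _ IH2] v; rewrite ?IH1 //.
by rewrite !magnus_cat /= magnus_letterK.
Qed.

Lemma magnusKV u v : magnus (winv u) (magnus u v) = v.
Proof.
rewrite -magnus_cat (@magnus_freeq _ [::]) //.
exact: (gmulVl (free_group_is_group L) u).
Qed.

Lemma magnusVK u v : magnus u (magnus (winv u) v) = v.
Proof.
rewrite -magnus_cat (@magnus_freeq _ [::]) //.
exact: (gmulVr (free_group_is_group L) u).
Qed.

Lemma magnusB u v v' : magnus u (fun i => v i - v' i) = (fun i => magnus u v i - magnus u v' i).
Proof.
elim: u => [|[l b] u IH] //=; rewrite IH.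
apply: functional_extensionality => i; case: b; rewrite /magnus_letter /=.
  by elim: i => [|i IHi] //=; rewrite IHi; ring.
by case: i => [|i] //=; ring.
Qed.

(** Each letter changes an entry only by multiples of earlier entries, so [magnus u] is lower
    triangular with ones on the diagonal. *)
Lemma magnus_unitriangular u v i :
  (forall j, (j < i)%N -> v j = 0) ->
  (forall j, (j < i)%N -> magnus u v j = 0) /\ magnus u v i = v i.
Proof.
move=> hv; elim: u => [|[l b] u [IH0 IH]] //=.
have step j : (j <= i)%N -> magnus_letter (l, b) (magnus u v) j = magnus u v j.
  case: b; rewrite /magnus_letter /=.
    elim: j => [|j IHj] //= ji; rewrite (IHj (ltnW ji)) (IH0 j ji); ring.
  by case: j => [|j] //= ji; rewrite (IH0 j ji); ring.
by split=> [j ji|]; rewrite step // ?IH0 // ltnW.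
Qed.
End MagnusAction.

(** * The genus h + 1 surface group acting on sequences of functions of time *)

Section SurfaceAction.
Variable h : nat.

Notation X := ('I_h * bool)%type.
Notation L := (option (X * int)).

(** In the alphabet L, [Some (x, j)] stands for a^-j x a^j and [None] for b. *)
Definition at_time (j : int) (w : word X) : word L :=
  map (fun p => (Some (p.1, j), p.2)) w.

Definition rel_at j := at_time j (surface_rel h).

(** Write r_t for [rel_at t]. Iterating a^-1 b a = b r gives b r_0 ... r_(j-1) at times j >= 0, and
    b r_(-1)^-1 ... r_j^-1 at times j < 0, where [Negz n] is -(n + 1). *)
Fixpoint beta_pos n : word L :=
  if n is n'.+1 then beta_pos n' ++ rel_at (Posz n') else [:: (None, false)].

Fixpoint beta_neg n : word L :=
  (if n is n'.+1 then beta_neg n' else [:: (None, false)]) ++ winv (rel_at (Negz n)).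

(* Free-group form of [a^-j b a^j], see [beta_succ]. *)
Definition beta (j : int) : word L :=
  match j with Posz n => beta_pos n | Negz n => beta_neg n end.

Lemma beta_succ j : freeq (beta (j + 1)) (beta j ++ rel_at j).
Proof.
have e (u v : free_group L) : geq u (gmul (gmul u (ginv v)) v).
  by group_id (free_group_is_group L).
case: j => [n|[|n]]; first by rewrite -PoszD addn1; apply: fq_refl.
  exact: e.
have -> : (Negz n.+1 + 1)%R = Negz n by lia.
exact: e.
Qed.

(* [None] stands for [a = a_1], [Some None] for [b = a_2]. *)
Definition letter_kind (y : 'I_h.+1 * bool) : option (option X) :=
  match unlift ord0 y.1 with
  | Some i => Some (Some (i, y.2))
  | None => if y.2 then Some None else None
  end.

Definition delta (o : option X) (j : int) : word L :=
  if o is Some x then [:: (Some (x, j), false)] else beta j.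

Definition word_sign (A : Type) (b : bool) (u : word A) := if b then winv u else u.

Local Open Scope ring_scope.

(** The letter a itself shifts by -1. With this sign, a^-j x a^j acts at time 0 through the letter
    [Some (x, j)]. *)
Definition shift_sign (b : bool) : int := if b then 1 else -1.

Variable phi : L -> nat -> int.
Notation space := (nat -> int -> int).

Definition act_letter (p : ('I_h.+1 * bool) * bool) (f : space) : space :=
  match letter_kind p.1 with
  | None => fun i j => f i (j + shift_sign p.2)
  | Some o => fun i j => magnus phi (word_sign p.2 (delta o j)) (f^~ j) i
  end.

Definition act (u : Fg h.+1) (f : space) : space := foldr act_letter f u.

Lemma act_cat u v f : act (u ++ v) f = act u (act v f).
Proof. exact: foldr_cat. Qed.

Lemma act_letterK a b f : act_letter (a, b) (act_letter (a, ~~ b) f) = f.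
Proof.
rewrite /act_letter /=; case: (letter_kind a) => [o|].
  apply: functional_extensionality => i; apply: functional_extensionality => j.
  by case: b => /=; rewrite ?magnusKV ?magnusVK.
apply: functional_extensionality => i; apply: functional_extensionality => j.
by congr f; case: b => /=; lia.
Qed.

Lemma act_freeq u v : freeq u v -> act u =1 act v.
Proof.
elim=> [u1 v1 a b|//|u1 v1 _ IH|u1 v1 w1 _ IH1 _ IH2] f; rewrite ?IH1 //.
by rewrite !act_cat /= act_letterK.
Qed.

Lemma actKV u f : act (winv u) (act u f) = f.
Proof.
rewrite -act_cat (@act_freeq _ [::]) //.
exact: (gmulVl (free_group_is_group _) u).
Qed.

Lemma actVK u f : act u (act (winv u) f) = f.
Proof.
rewrite -act_cat (@act_freeq _ [::]) //.
exact: (gmulVr (free_group_is_group _) u).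
Qed.

Lemma actB u f f' :
  act u (fun i j => f i j - f' i j) = (fun i j => act u f i j - act u f' i j).
Proof.
elim: u => [|[y b] u IH] //=; rewrite IH /act_letter.
case: (letter_kind _) => [o|] //.
apply: functional_extensionality => i; apply: functional_extensionality => j.
by rewrite magnusB.
Qed.

Definition lift_letter (x : X) : 'I_h.+1 * bool := (lift ord0 x.1, x.2).
Definition lift_word (w : word X) : Fg h.+1 := map (fun p => (lift_letter p.1, p.2)) w.

Lemma letter_kind_lift x : letter_kind (lift_letter x) = Some (Some x).
Proof. by rewrite /letter_kind /= liftK; case: x. Qed.

Lemma letter_kind_a : letter_kind (ord0, false) = None.
Proof. by rewrite /letter_kind unlift_none. Qed.

Lemma letter_kind_b : letter_kind (ord0, true) = Some None.
Proof. by rewrite /letter_kind unlift_none. Qed.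

Lemma surface_rel_succ :
  surface_rel h.+1 = comm (gen_letter ord0 false) (gen_letter ord0 true)
                       ++ lift_word (surface_rel h).
Proof.
pose F n (i : 'I_n) (r : Fg n) := gmul (comm (gen_letter i false) (gen_letter i true)) r.
have e (s : seq 'I_h) :
    foldr (F h.+1) gone (map (lift ord0) s) = lift_word (foldr (F h) gone s).
  by elim: s => [|i s IH] //=; rewrite IH.
by rewrite {1}/surface_rel enum_ordSl -e.
Qed.

Lemma act_lift_word w f i j : act (lift_word w) f i j = magnus phi (at_time j w) (f^~ j) i.
Proof.
suff -> : act (lift_word w) f = fun i j => magnus phi (at_time j w) (f^~ j) i by [].
elim: w => [|[x b] w IH] //=; rewrite IH /act_letter /= letter_kind_lift.
apply: functional_extensionality => {}i; apply: functional_extensionality => {}j.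
by case: b.
Qed.

(** At time j the two shifts in [a, b] r turn the action into that of beta(j+1)^-1 beta(j) r_j,
    which is trivial by [beta_succ]. *)
Lemma act_surface_rel f : act (surface_rel h.+1) f = f.
Proof.
have hr : act (lift_word (surface_rel h)) f = fun i j => magnus phi (rel_at j) (f^~ j) i.
  apply: functional_extensionality => i; apply: functional_extensionality => j.
  exact: act_lift_word.
rewrite surface_rel_succ act_cat hr /= /act_letter /= letter_kind_a letter_kind_b /=.
apply: functional_extensionality => i; apply: functional_extensionality => j.
rewrite addrK -(magnus_cat phi (beta j)) -(magnus_freeq phi (beta_succ j)).
by rewrite magnusKV.
Qed.

Lemma act_wncl u f : wncl h.+1 u -> act u f = f.
Proof.
move=> hu; elim: hu f => {u}.
- move=> _ [s [g [-> ->]]] f; rewrite /conj /= !act_cat act_surface_rel.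
  exact: actKV.
- by [].
- by move=> u v _ hu _ hv f; rewrite act_cat hv.
- by move=> u _ hu f; rewrite -{1}[f]hu actKV.
- by move=> u v uv _ hu f; rewrite -(act_freeq uv).
Qed.
End SurfaceAction.

(** * Unipotence *)

Section Differences.
Local Open Scope ring_scope.

(* Polynomial functions of degree less than [e]. *)
Fixpoint deg_lt (e : nat) (h : int -> int) : Prop :=
  if e is e'.+1 then deg_lt e' (fun j => h (j + 1) - h j) else forall j, h j = 0.

Lemma deg_lt_ext e h h' : h =1 h' -> deg_lt e h -> deg_lt e h'.
Proof. by move=> /functional_extensionality ->. Qed.

Lemma deg_lt_zero e : deg_lt e (fun=> 0).
Proof. by elim: e => [|e IH] //=; apply: deg_lt_ext IH. Qed.

Lemma deg_ltB e h h' : deg_lt e h -> deg_lt e h' -> deg_lt e (fun j => h j - h' j).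
Proof.
elim: e h h' => [|e IH] h h' /= hh hh'; first by move=> j; rewrite hh hh'.
by apply: deg_lt_ext (IH _ _ hh hh') => j; ring.
Qed.

Lemma deg_ltN e h : deg_lt e h -> deg_lt e (fun j => - h j).
Proof. by move=> hh; apply: deg_lt_ext (deg_ltB (deg_lt_zero e) hh) => j; ring. Qed.

Lemma deg_ltD e h h' : deg_lt e h -> deg_lt e h' -> deg_lt e (fun j => h j + h' j).
Proof. by move=> hh /deg_ltN hh'; apply: deg_lt_ext (deg_ltB hh hh') => j; ring. Qed.

Lemma deg_ltS e h : deg_lt e h -> deg_lt e.+1 h.
Proof.
elim: e h => [|e IH] h /= hh; first by move=> j; rewrite !hh.
exact: IH.
Qed.

Lemma deg_lt_mono e e' h : (e <= e')%N -> deg_lt e h -> deg_lt e' h.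
Proof.
by move=> /subnKC <- hh; elim: (e' - e)%N => [|d IH]; rewrite ?addn0 ?addnS //; apply: deg_ltS.
Qed.

Lemma deg_lt_shift e h c : deg_lt e h -> deg_lt e (fun j => h (j + c)).
Proof.
elim: e h => [|e IH] h /= hh; first by move=> j.
by apply: deg_lt_ext (IH _ hh) => j; rewrite [j + 1 + c]addrAC.
Qed.

Lemma deg_lt_diff e h c : c = 1 \/ c = -1 ->
  deg_lt e h -> deg_lt e.-1 (fun j => h (j + c) - h j).
Proof.
case: e => [|e] hc /= hh; first by move=> j; rewrite !hh.
case: hc => -> //.
apply: deg_lt_ext (deg_ltN (deg_lt_shift (-1) hh)) => j /=.
by rewrite subrK opprB.
Qed.

(** Leibniz rule: the difference of (j - c) h(j) is (j - c) times the difference of h, plus h(j +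
    1). *)
Lemma deg_lt_mul_linear e h c : deg_lt e h -> deg_lt e.+1 (fun j => (j - c) * h j).
Proof.
elim: e h => [|e IH] h hh; first by move=> j; rewrite !hh; ring.
have h1 := IH _ hh; have h2 : deg_lt e.+1 (fun j => h (j + 1)) by apply: deg_lt_shift.
by apply: deg_lt_ext (deg_ltD h1 h2) => j /=; ring.
Qed.

End Differences.

(** * Degree filtration and the lower central series *)

Section Filtration.
Variables (h : nat).
Notation X := ('I_h * bool)%type.
Notation L := (option (X * int)).
Variables (phi : L -> nat -> int) (Q : nat).
Hypothesis Q_gt0 : 0 < Q.
Hypothesis phi_deg : forall x i e (g : int -> int), deg_lt e g ->
  deg_lt (e + Q.-1) (fun j => phi (Some (x, j)) i * g j)%R.

Notation space := (nat -> int -> int).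
Notation act := (act phi).
Local Open Scope ring_scope.

(** With slope Q both kinds of moves gain one: a time difference lowers the degree by one, while
    multiplication by [phi] raises it by at most Q - 1 but passes from index i to i + 1, where the
    bound is larger by Q. Subtraction truncates, so component i vanishes once m >= (i + 1) Q. *)
Definition filt m (f : space) := forall i, deg_lt (i.+1 * Q - m) (f i).

Lemma filtB m f f' : filt m f -> filt m f' -> filt m (fun i j => f i j - f' i j).
Proof. by move=> hf hf' i; apply: deg_ltB. Qed.

Lemma filtD m f f' : filt m f -> filt m f' -> filt m (fun i j => f i j + f' i j).
Proof. by move=> hf hf' i; apply: deg_ltD. Qed.

Lemma filt_mono m m' f : (m' <= m)%N -> filt m f -> filt m' f.
Proof. by move=> mm hf i; apply: deg_lt_mono (hf i); apply: leq_sub2l. Qed.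

Lemma filt_ext m f f' : (forall i j, f i j = f' i j) -> filt m f -> filt m f'.
Proof. by move=> e hf i; apply: deg_lt_ext (hf i) => j. Qed.

Lemma filt_shift m f c : filt m f -> filt m (fun i j => f i (j + c)).
Proof. by move=> hf i; apply: deg_lt_shift. Qed.

Lemma filt_diff m f c : c = 1 \/ c = -1 ->
  filt m f -> filt m.+1 (fun i j => f i (j + c) - f i j).
Proof. by move=> hc hf i; rewrite subnS; apply: deg_lt_diff. Qed.

Definition raises k (u : Fg h.+1) :=
  forall m f, filt m f -> filt (m + k) (fun i j => act u f i j - f i j).

Lemma raises_filt k u m f : raises k u -> filt m f -> filt m (act u f).
Proof.
move=> hu hf; have := filtD (filt_mono (leq_addr k m) (hu _ _ hf)) hf.
by apply: filt_ext => i j; rewrite subrK.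
Qed.

Lemma raises_nil k : raises k [::].
Proof. by move=> m f hf i; apply: deg_lt_ext (deg_lt_zero _) => j /=; rewrite subrr. Qed.

Lemma raises_cat k u v : raises k u -> raises k v -> raises k (u ++ v).
Proof.
move=> hu hv m f hf; have := filtD (hu _ _ (raises_filt hv hf)) (hv _ _ hf).
by apply: filt_ext => i j; rewrite act_cat; ring.
Qed.

(** u^-1 - 1 = -(u - 1) u^-1; the hypothesis on [winv u] ensures that u^-1 preserves the
    filtration. *)
Lemma raises_inv k l u : raises k u -> raises l (winv u) -> raises k (winv u).
Proof.
move=> hu hu' m f hf; have hg := raises_filt hu' hf.
have := filtB (fun i => deg_lt_zero _) (hu _ _ hg).
by apply: filt_ext => i j; rewrite actVK; ring.
Qed.

(** [x, y] - 1 = x^-1 y^-1 ((x - 1)(y - 1) - (y - 1)(x - 1)). *)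
Lemma raises_comm k l (x y : Fg h.+1) :
  raises 1 (winv x) -> raises 1 (winv y) -> raises k x -> raises l y ->
  raises (k + l) (comm x y).
Proof.
move=> hx' hy' hx hy m f hf.
have h1 := hx _ _ (hy _ _ hf); have h2 := hy _ _ (hx _ _ hf).
rewrite -addnA [(l + k)%N]addnC in h1; rewrite -addnA in h2.
have := raises_filt (raises_cat hx' hy') (filtB h1 h2).
apply: filt_ext => i j.
have -> : (fun i j => act x (fun i j => act y f i j - f i j) i j - (act y f i j - f i j)
      - (act y (fun i j => act x f i j - f i j) i j - (act x f i j - f i j))) =
    (fun i j => act x (act y f) i j - act y (act x f) i j).
  apply: functional_extensionality => i'; apply: functional_extensionality => j'.
  by rewrite !actB; ring.
rewrite actB /comm /= !act_cat.
by rewrite [act (winv y) (act y _)]actKV [act (winv x) (act x _)]actKV.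
Qed.

Lemma filt_phi_mul x i m g : deg_lt (i.+1 * Q - m) g ->
  deg_lt (i.+2 * Q - m.+1) (fun j => phi (Some (x, j)) i * g j).
Proof.
(* If the truncated bound is 0 then g vanishes; otherwise the subtraction is exact and the bounds
   add up. *)
case: (posnP (i.+1 * Q - m)) => [-> g0|pos hg].
  by apply: deg_lt_ext (deg_lt_zero _) => j /=; rewrite g0 mulr0.
apply: deg_lt_mono (phi_deg x i hg); rewrite !mulSn; move: pos; rewrite !mulSn.
by move: (i * Q)%N Q_gt0 => c; lia.
Qed.

Lemma raises_lift_letter x b : raises 1 [:: (lift_letter x, b)].
Proof.
move=> m f hf; rewrite /= /act_letter letter_kind_lift addn1.
have fwd : filt m.+1 (fun i j => magnus phi [:: (Some (x, j), false)] (f^~ j) i - f i j).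
  case=> [|i]; first by apply: deg_lt_ext (deg_lt_zero _) => j /=; rewrite /magnus /magnus_letter /=; ring.
  apply: deg_lt_ext (filt_phi_mul x (hf i)) => j; rewrite /magnus /magnus_letter /=; ring.
case: b; last exact: fwd.
have bwd_eq i j : magnus_bwd phi (Some (x, j)) (f^~ j) i.+1 - f i.+1 j =
    - (phi (Some (x, j)) i * magnus_bwd phi (Some (x, j)) (f^~ j) i).
  by rewrite /=; ring.
have bwd i : deg_lt (i.+1 * Q - m) (fun j => magnus_bwd phi (Some (x, j)) (f^~ j) i).
  elim: i => [|i IH]; first exact: hf.
  apply: deg_lt_ext (deg_ltB (hf i.+1) (deg_lt_mono _ (filt_phi_mul x IH))) => //.
  exact: leq_sub2l.
case=> [|i]; first by apply: deg_lt_ext (deg_lt_zero _) => j /=; rewrite subrr.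
by apply: deg_lt_ext (deg_ltN (filt_phi_mul x (bwd i))) => j; rewrite /= -bwd_eq.
Qed.

Lemma raises_a b : raises 1 [:: ((ord0, false), b)].
Proof.
move=> m f hf; rewrite /= /act_letter letter_kind_a addn1.
by apply: filt_diff => //; case: b; [left|right].
Qed.

Lemma raises_lift_surface_rel : raises 2 (lift_word (surface_rel h)).
Proof.
rewrite /surface_rel; elim: (enum 'I_h) => [|i s IH]; first exact: raises_nil.
have c : raises 2 (comm ([:: (lift_letter (i, false), false)] : Fg h.+1)
                        [:: (lift_letter (i, true), false)]).
  by apply: (@raises_comm 1 1); apply: raises_lift_letter.
exact: (raises_cat c IH).
Qed.

Notation bletter := [:: ((ord0, true) : 'I_h.+1 * bool, false)].

Lemma act_b f i j : act bletter f i j = magnus phi (beta h j) (f^~ j) i.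
Proof. by rewrite /= /act_letter letter_kind_b. Qed.

Lemma act_b_succ f i j :
  act bletter f i (j + 1) =
  act bletter (act (lift_word (surface_rel h)) (fun i j => f i (j + 1))) i j.
Proof.
rewrite !act_b (magnus_freeq phi (beta_succ h j)) magnus_cat.
by congr magnus; apply: functional_extensionality => k; rewrite act_lift_word.
Qed.

(** The length of [beta h j] grows with |j|, so a letterwise estimate fails. The degree is instead
    bounded through the time difference, by induction on (i + 1) Q - m. *)
Lemma raises_b : raises 1 bletter.
Proof.
suff main d i m f : (i.+1 * Q - m <= d)%N -> filt m f ->
    deg_lt (i.+1 * Q - m.+1) (fun j => act bletter f i j - f i j).
  by move=> m f hf i; rewrite addn1; apply: main hf.
(* With T the shift by 1 and Delta = T - 1, the relation T b = b r T gives
   Delta (b - 1) f = (b - 1) (r T - 1) f + (r - 1) T f, and r raises by 2. *)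
set r := lift_word (surface_rel h).
elim: d m f => [|d IH] m f le_d hf; case: (leqP (i.+1 * Q) m.+1) => le_iQ; try lia.
(* If the target bound is 0, all components k < i of f vanish, as (k + 1) Q <= i Q <= m, and
   unitriangularity shows that b fixes component i. *)
1,2: have /eqP -> : (i.+1 * Q - m.+1 == 0)%N by rewrite subn_eq0.
1,2: move=> j; rewrite act_b; have [k ki|_ ->] := @magnus_unitriangular _ phi (beta h j) (f^~ j) i;
  last exact: subrr.
1,2: have := hf k; have /eqP -> : (k.+1 * Q - m == 0)%N; last exact.
1,2: rewrite subn_eq0; have := leq_mul ki (leqnn Q); move: le_iQ; rewrite !mulSn.
1,2: move: (k * Q)%N (i * Q)%N Q_gt0 => a b; lia.
case e : (i.+1 * Q - m.+1)%N => [|e']; first by exfalso; lia.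
change (deg_lt e' (fun j => (act bletter f i (j + 1) - f i (j + 1))
  - (act bletter f i j - f i j))).
pose Tf : space := fun i j => f i (j + 1).
have hTf : filt m Tf by apply: filt_shift.
pose f' : space := fun i j => act r Tf i j - f i j.
have hR := raises_lift_surface_rel hTf.
have hf' : filt m.+1 f'.
  have hT : filt m.+1 (fun i j => Tf i j - f i j) by apply: filt_diff => //; left.
  have := filtD (filt_mono _ hR) hT; rewrite addn2 => /(_ (leqnSn _)).
  by apply: filt_ext => i' j'; rewrite /f'; ring.
have h1 : deg_lt e' (fun j => act bletter f' i j - f' i j).
  have := IH _ _ _ hf'; rewrite [(_ - m.+2)%N]subnS e /=; apply; lia.
have h2 : deg_lt e' (fun j => act r Tf i j - Tf i j).
  by have := hR i; rewrite addn2 [(_ - m.+2)%N]subnS e.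
apply: deg_lt_ext (deg_ltD h1 h2) => j.
by rewrite act_b_succ /f' actB /Tf; ring.
Qed.

Lemma raises_bV : raises 1 (winv bletter).
Proof.
move=> m f hf; set g := act (winv bletter) f.
have gE : act bletter g = f by apply: actVK.
suff hg : filt m g.
  have := filtB (fun i => deg_lt_zero _) (raises_b hg).
  by apply: filt_ext => i j; rewrite gE; ring.
elim/ltn_ind => i IH.
(* As g - g' vanishes below i, unitriangularity gives g_i = f_i - ((b - 1) g')_i, whose right side
   involves only components of g below i. *)
pose g' : space := fun k j => if (k < i)%N then g k j else 0.
have hg' : filt m g'.
  by move=> k; rewrite /g'; case: ltnP => [/IH|] // _; apply: deg_lt_zero.
have e j : g i j = f i j - (act bletter g' i j - g' i j).
  have := @magnus_unitriangular _ phi (beta h j) (fun k => g k j - g' k j) i.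
  rewrite magnusB -!act_b gE => -[k ki|_ eq]; last by lia.
  by rewrite /g' ki subrr.
apply: deg_lt_ext (deg_ltB (hf i) (filt_mono (leq_addr 1 m) (raises_b hg') i)) => j.
by rewrite e.
Qed.

Lemma raises_letter p : raises 1 [:: p].
Proof.
case: p => [[i c] b]; case: (unliftP ord0 i) => [i'|] ->.
  exact: (raises_lift_letter (i', c)).
case: c; last exact: raises_a.
by case: b; [apply: raises_bV | apply: raises_b].
Qed.

Lemma raises1 u : raises 1 u.
Proof.
elim: u => [|p u IH]; first exact: raises_nil.
exact: (raises_cat (raises_letter p) IH).
Qed.

Lemma raises_lcs k (u : Fg h.+1) : lcs (Gamma h.+1) k u -> raises k.+1 u.
Proof.
elim: k u => [|k IH] u; first by move=> _; apply: raises1.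
elim=> {u}.
- move=> _ [x [y [_ [hy ->]]]].
  by apply: (@raises_comm 1 k.+1); rewrite ?add1n; [apply: raises1..|apply: IH].
- exact: raises_nil.
- by move=> x y _ hx _ hy; apply: raises_cat.
- by move=> x _ hx; apply: raises_inv hx (@raises1 _).
- move=> x y xy _ hx m f hf; apply: filt_ext (hx m f hf) => i j.
  by have := act_wncl phi f xy; rewrite act_cat => e; rewrite -[in RHS](actVK phi x (act y f)) e.
Qed.

Lemma act_residual (u : Fg h.+1) f : (forall k, (0 < k)%N -> gamma (Gamma h.+1) k u) ->
  filt 0 f -> forall i j, act u f i j = f i j.
Proof.
move=> hu hf i j; apply/eqP; rewrite -subr_eq0; apply/eqP.
(* This depth exceeds (i + 1) Q, so the degree bound on component i of (u - 1) f is 0. *)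
have := raises_lcs (hu (i.+1 * Q).+1 isT) hf i.
by rewrite add0n subnS subnn /=; apply.
Qed.
End Filtration.

(** * Faithfulness *)

Lemma ncl_normal (G : sgroup) (hG : is_group G) (S : G -> Prop) : is_normal (ncl S).
Proof.
split; [exact: gen_one|exact: gen_mul|exact: gen_inv|exact: gen_eq|].
move=> x g; elim=> {x}.
- move=> _ [s [k [hs ->]]]; apply: (@gen_eq _ _ (conj s (gmul k g))).
    by group_id hG.
  by apply: gen_in; exists s, (gmul k g).
- by apply: (@gen_eq _ _ gone); [group_id hG | apply: gen_one].
- move=> x y _ hx _ hy; apply: (@gen_eq _ _ (gmul (conj x g) (conj y g))).
    by group_id hG.
  exact: gen_mul.
- move=> x _ hx; apply: (@gen_eq _ _ (ginv (conj x g))); first by group_id hG.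
  exact: gen_inv.
- move=> x y xy _ hx; apply: gen_eq hx; have r := geq_refl hG.
  by do !apply: gmul_congr => //.
Qed.

Lemma Gamma_group g : is_group (Gamma g).
Proof. by apply: quot_group; [|apply: ncl_normal]; apply: free_group_is_group. Qed.

(** * Elements as a word in the kernel times a power of a *)

Section KernelWords.
Variable h : nat.
Notation X := ('I_h * bool)%type.
Notation L := (option (X * int)).
Local Open Scope ring_scope.

(* [a^-j u = K_word u j * a^(-j - offset u)] in the surface group. *)
Fixpoint K_word (u : Fg h.+1) (j : int) : word L :=
  match u with
  | [::] => [::]
  | (y, b) :: u' => match letter_kind y with
    | None => K_word u' (j + shift_sign b)
    | Some o => word_sign b (delta o j) ++ K_word u' j
    end
  end.

Fixpoint offset (u : Fg h.+1) : int :=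
  match u with
  | [::] => 0
  | (y, b) :: u' =>
      if letter_kind y is None then offset u' + shift_sign b else offset u'
  end.

Lemma act_K_word phi u f i j :
  act phi u f i j = magnus phi (K_word u j) (fun i => f i (j + offset u)) i.
Proof.
elim: u i j => [|[y b] u IH] i j /=; first by rewrite addr0.
rewrite /act_letter /=; case: (letter_kind y) => [o|].
  rewrite magnus_cat; congr magnus; apply: functional_extensionality => k.
  exact: IH.
by rewrite IH [offset u + _]addrC addrA.
Qed.

Let hF := free_group_is_group ('I_h.+1 * bool)%type.
Let hS := Gamma_group h.+1.
Notation S := (Gamma h.+1).

Definition a_gen : S := @gen_letter h.+1 ord0 false.
Definition b_gen : S := @gen_letter h.+1 ord0 true.

Definition K_letter (l : L) : S :=
  if l is Some (x, j) then @conj S [:: (lift_letter x, false)] (zpow a_gen j) else b_gen.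
Definition K_eval (u : word L) : S := word_eval K_letter u.

Lemma K_eval_at_time j w :
  @geq S (K_eval (at_time j w)) (@conj S (lift_word w) (zpow a_gen j)).
Proof.
elim: w => [|[x b] w IH]; first by change (@geq S gone (conj gone (zpow (a_gen : S) j))); group_id hS.
rewrite -[lift_word _]/(@gmul S [:: (lift_letter x, b)] (lift_word w)).
rewrite -[K_eval _]/(@gmul S (letter_eval K_letter (Some (x, j), b)) (K_eval (at_time j w))).
apply: (geq_trans hS (gmul_congr hS (geq_refl hS _) IH)).
set l : S := [:: (lift_letter x, false)]; set v : S := lift_word w.
set z : S := zpow a_gen j.
case: b.
- by change (@geq S (gmul (ginv (conj l z)) (conj v z)) (conj (gmul (ginv l) v) z)); group_id hS.
- by change (@geq S (gmul (conj l z) (conj v z)) (conj (gmul l v) z)); group_id hS.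
Qed.

Lemma conj_b_a : @geq S (conj b_gen a_gen) (gmul b_gen (lift_word (surface_rel h))).
Proof.
have w1 : @geq S gone (surface_rel h.+1).
  apply: (@gen_eq _ _ (@conj (Fg h.+1) (surface_rel h.+1) gone)).
    by group_id hF.
  by apply: gen_in; exists (surface_rel h.+1), gone.
rewrite surface_rel_succ in w1.
set r : S := lift_word _ in w1 *.
have {}w1 : @geq S gone (gmul (comm a_gen b_gen) r) by exact: w1.
apply: (geq_trans hS (y := gmul (conj b_gen a_gen) gone)); first by group_id hS.
apply: (geq_trans hS (gmul_congr hS (geq_refl hS _) w1)).
group_id hS.
Qed.

(** Both sides equal b at j = 0 and are multiplied on the right by the same invertible factor r_k
    from k to k + 1; this determines them in both directions of time. *)
Lemma K_eval_beta j : @geq S (K_eval (beta h j)) (conj b_gen (zpow a_gen j)).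
Proof.
have step1 (k : int) : @geq S (K_eval (beta h (k + 1)))
    (gmul (K_eval (beta h k)) (K_eval (rel_at h k))).
  apply: (geq_trans hS (word_eval_freeq hS K_letter (beta_succ h k))).
  exact: word_eval_cat.
have step2 (k : int) : @geq S (conj b_gen (zpow a_gen (k + 1)))
    (gmul (conj b_gen (zpow a_gen k)) (K_eval (rel_at h k))).
  have r := geq_refl hS; have e := zpowS hS a_gen k.
  apply: (geq_trans hS (y := conj (conj b_gen a_gen) (zpow a_gen k))).
    apply: (geq_trans hS (y := conj b_gen (gmul a_gen (zpow a_gen k)))); last by group_id hS.
    by do !apply: gmul_congr => //; apply: ginv_congr.
  apply: (geq_trans hS (y := conj (gmul b_gen (lift_word (surface_rel h))) (zpow a_gen k))).
    exact: (gmul_congr hS (gmul_congr hS (r _) conj_b_a) (r _)).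
  apply: (geq_trans hS (y := gmul (conj b_gen (zpow a_gen k))
     (@conj S (lift_word (surface_rel h)) (zpow a_gen k)))); first by group_id hS.
  apply: gmul_congr => //; apply: geq_sym => //; exact: K_eval_at_time.
elim/int_ind: j => [|n IH|n IH].
- by change (@geq S (gmul b_gen gone) (conj b_gen gone)); group_id hS.
- have e : (n.+1%:Z = n%:Z + 1)%R by lia.
  rewrite e; apply: (geq_trans hS (step1 _)); apply: (geq_trans hS _ (geq_sym hS (step2 _))).
  exact: (gmul_congr hS IH (geq_refl hS _)).
- have e : (- (n%:Z) = - (n.+1%:Z) + 1)%R by lia.
  rewrite e in IH; move: IH; move: (- _)%R => k IH.
  have {}IH := geq_trans hS (geq_trans hS (geq_sym hS (step1 k)) IH) (step2 k).
  move: IH; move: (K_eval _) (conj _ _) (K_eval _) => r y x IH.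
  apply: (geq_trans hS (y := gmul (gmul x r) (ginv r))); first by group_id hS.
  apply: (geq_trans hS (gmul_congr hS IH (geq_refl hS _))); group_id hS.
Qed.

Lemma K_eval_delta (y : 'I_h.+1 * bool) o j : letter_kind y = Some o ->
  @geq S (K_eval (delta o j)) (@conj S [:: (y, false)] (zpow a_gen j)).
Proof.
case: y => i c; case: (unliftP ord0 i) => [i'|] ->.
  rewrite (letter_kind_lift (i', c)) => -[<-].
  set l : S := [:: (lift_letter (i', c), false)].
  by change (@geq S (gmul (conj l (zpow a_gen j)) gone) (conj l (zpow a_gen j))); group_id hS.
case: c; last by rewrite letter_kind_a.
by rewrite letter_kind_b => -[<-]; apply: K_eval_beta.
Qed.

Lemma K_wordP u j : @geq S (gmul (K_eval (K_word u j)) (zpow a_gen (- j - offset u)))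
  (gmul (zpow a_gen (- j)) u).
Proof.
elim: u j => [|[y b] u IH] j.
  change (@geq S (gmul gone (zpow a_gen (- j - 0))) (gmul (zpow a_gen (- j)) gone)).
  by rewrite subr0; group_id hS.
rewrite -[X in geq _ (gmul _ X)]/(@gmul S [:: (y, b)] u) [K_word _ _]/= [offset _]/=.
case e : (letter_kind y) => [o|].
  apply: (geq_trans hS (y := gmul (gmul (K_eval (word_sign b (delta o j))) (K_eval (K_word u j)))
     (zpow a_gen (- j - offset u)))).
    by apply: gmul_congr => //; [exact: word_eval_cat | exact: geq_refl].
  apply: (geq_trans hS (gmulA hS _ _ _)).
  apply: (geq_trans hS (gmul_congr hS (geq_refl hS _) (IH j))).
  have hd := K_eval_delta j e; have hz := zpowN hS a_gen j.
  have hb : @geq S (K_eval (word_sign b (delta o j))) (@conj S [:: (y, b)] (zpow a_gen j)).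
    case: b {IH} => //; apply: (geq_trans hS (word_eval_inv hS _ _)).
    apply: (geq_trans hS (ginv_congr hS hd)).
    rewrite -[[:: (y, true)]]/(@ginv S [:: (y, false)]); group_id hS.
  apply: (geq_trans hS (gmul_congr hS hb (gmul_congr hS hz (geq_refl hS _)))).
  apply: (geq_trans hS _ (gmul_congr hS (geq_sym hS hz) (geq_refl hS _))).
  group_id hS.
have -> : - j - (offset u + shift_sign b) = - (j + shift_sign b) - offset u by ring.
apply: (geq_trans hS (IH _)); apply: (geq_trans hS _ (gmulA hS _ _ _)).
apply: gmul_congr => //; last exact: geq_refl.
have ey : y = (ord0, false).
  case: y e => i c; case: (unliftP ord0 i) => [i'|] ->.
    by rewrite (letter_kind_lift (i', c)).
  by case: c => //; rewrite letter_kind_b.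
have hb : @geq S [:: (y, b)] (zpow a_gen (- shift_sign b)).
  rewrite ey; case: b {IH}.
    by change (@geq S (ginv a_gen) (gmul (ginv a_gen) gone)); group_id hS.
  by change (@geq S a_gen (gmul a_gen gone)); group_id hS.
rewrite opprD; apply: (geq_trans hS (zpowD hS _ _ _)).
by apply: gmul_congr => //; [exact: geq_refl | exact: geq_sym].
Qed.

(** At j = 0 and with offset 0, [K_wordP] says that u is the value of [K_word u 0] in the surface
    group. *)
Lemma K_word_faithful u : freeq (K_word u 0) [::] -> offset u = 0 -> wncl h.+1 u.
Proof.
move=> hK h0; have := K_wordP u 0; rewrite h0 subr0 oppr0 => e.
have e1 := word_eval_freeq hS K_letter hK.
suff : @geq S gone u by apply: gen_eq; group_id hF.
apply: (geq_trans hS (y := gmul gone u)); last by group_id hS.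
apply: (geq_trans hS _ e); change (@geq S gone (gmul (K_eval (K_word u 0)) gone)).
apply: (geq_trans hS (y := gmul gone gone)); first by group_id hS.
by apply: gmul_congr => //; [exact: geq_sym | exact: geq_refl].
Qed.
End KernelWords.

(** * Detecting reduced words by the Magnus action *)

Section Syllables.
Variable L : eqType.

(* [(p, n)] stands for the syllable [p ^ (n + 1)]. *)
Definition syllables := seq ((L * bool) * nat).
Definition of_syllables (s : syllables) : word L :=
  flatten [seq nseq p.2.+1 p.1 | p <- s].
Definition reduced (s : syllables) := sorted (fun p q => p.1.1 != q.1.1) s.

Lemma syllables_exist u : exists2 s, reduced s & freeq u (of_syllables s).
Proof.
elim: u => [|[a b] u [s rs us]]; first by exists [::] => //; apply: fq_refl.
have {us} := freeq_catl [:: (a, b)] us; rewrite cat1s.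
case: s rs => [|[[c d] n] s] rs us; first by exists [:: ((a, b), 0)].
have [ac|ac] := eqVneq a c; last first.
  exists [:: ((a, b), 0), ((c, d), n) & s]; last exact: us.
  by rewrite /reduced /= ac.
move: rs us; rewrite -ac => rs us.
have rs' b' n' : reduced ((a, b', n') :: s) by case: (s) rs.
have [bd|bd] := eqVneq b d.
  by rewrite -bd in us; exists (((a, b), n.+1) :: s); [exact: rs' | exact: us].
have {}bd : d = ~~ b by case: b d bd {us rs} => [] [].
rewrite bd in us.
have red v : freeq ((a, b) :: (a, ~~ b) :: v) v by exact: (fq_red [::] v a b).
case: n rs us => [|n] rs us; last first.
  by exists (((a, ~~ b), n) :: s); [exact: rs' | exact: fq_trans us (red _)].
exists s; last exact: fq_trans us (red _).
exact: path_sorted rs.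
Qed.

Variable phi : L -> nat -> int.
Local Open Scope ring_scope.

Definition vac (i : nat) : int := (i == 0%N)%:R.

(** The zero coefficient at N - 1 keeps entry N fixed, and the one at N + 1 stops propagation past N
    + 1. Each of the n letters therefore adds the same multiple of v N to entry N + 1. *)
Lemma magnus_syllable l b n N v :
  phi l N.+1 = 0 -> ((0 < N)%N -> phi l N.-1 = 0) ->
  (forall i, (N < i)%N -> v i = 0) ->
  let w := magnus phi (nseq n (l, b)) v in
  [/\ w N = v N, w N.+1 = (if b then -1 else 1) * n%:R * phi l N * v N
    & forall i, (N.+1 < i)%N -> w i = 0].
Proof.
move=> h1 h2 hv /=; elim: n => [|n].
  by split=> //= [|i hi]; rewrite hv ?mulr0 ?mul0r // ltnW.
rewrite -[magnus phi (nseq n.+1 _) v]/(magnus_letter phi (l, b) (magnus phi (nseq n (l, b)) v)).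
move: (magnus _ _ _) => w [wN wN1 w0].
have bwd_zero i (x : nat -> int) : phi l N.-1 = 0 \/ N = 0%N -> N = i.+1 -> phi l i * x i = 0.
  by move=> [h ei|-> //]; rewrite ei /= in h; rewrite h mul0r.
have hN : phi l N.-1 = 0 \/ N = 0%N by case: (posnP N) => [->|/h2 ->]; [right|left].
rewrite /magnus_letter; case: b wN wN1 w0 => /= wN wN1 w0.
  have eN : magnus_bwd phi l w N = v N.
    case e : N => [|i] /=; first by rewrite -e.
    by rewrite (bwd_zero i) // subr0 -e.
  have eN1 : magnus_bwd phi l w N.+1 = (-1) * n.+1%:R * phi l N * v N.
    by rewrite /= eN wN1 -natr1; ring.
  split=> // i; elim: i => [|i IH] // hi.
  rewrite [LHS]/= w0 //; have [e|ne] := eqVneq i N.+1.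
    by rewrite e h1 mul0r subr0.
  by rewrite IH ?mulr0 ?subr0 // ltn_neqAle eq_sym ne.
split.
- case e : N => [|i] /=; first by rewrite -e.
  by rewrite (bwd_zero i) // addr0 -e.
- by rewrite wN wN1 -natr1; ring.
- case=> [|i] // hi; rewrite /= w0 //; have [e|ne] := eqVneq i N.+1.
    by rewrite e h1 mul0r addr0.
  by rewrite w0 ?mulr0 ?addr0 // ltn_neqAle eq_sym ne.
Qed.

(** The syllables in s' act first and bring the last nonzero entry of [vac] to index [size s']; the
    conditions let p move it exactly one index further. *)
Fixpoint separates (s : syllables) : Prop :=
  if s is p :: s' then
    [/\ phi p.1.1 (size s') <> 0, phi p.1.1 (size s').+1 = 0,
        (0 < size s')%N -> phi p.1.1 (size s').-1 = 0 & separates s']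
  else True.

(** The top entry is a product of signed exponents and nonzero coefficients, hence nonzero in Z. *)
Lemma magnus_separates s : separates s ->
  magnus phi (of_syllables s) vac (size s) <> 0 /\
  forall i, (size s < i)%N -> magnus phi (of_syllables s) vac i = 0.
Proof.
elim: s => [|[[l b] n] s IH]; first by move=> _; split=> //; case.
move=> [h0 h1 h2 /IH [v0 vs]].
have -> : of_syllables ((l, b, n) :: s) = nseq n.+1 (l, b) ++ of_syllables s by [].
rewrite magnus_cat.
have [_ e es] := magnus_syllable b n.+1 h1 h2 vs; split=> //.
rewrite [size _]/= e; apply/eqP; rewrite !mulf_neq0 //; try exact/eqP.
  by case: (b).
by rewrite pnatr_eq0.
Qed.
End Syllables.

(** * Interpolation of separating coefficients, polynomial in time *)

Section SeparatingCoefficients.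
Variable X : eqType.
Notation L := (option (X * int)).
Local Open Scope ring_scope.

(* A polynomial in the time of [l], which is nonzero at [l = l'] and vanishes
   at the other letters with times in [T]. *)
Definition letter_poly (T : seq int) (l l' : L) : int :=
  match l, l' with
  | Some (x, j), Some (x', j') => if x == x' then \prod_(t <- T | t != j') (j - t) else 0
  | None, None => 1
  | _, _ => 0
  end.

(** Reversed because the rightmost syllable acts first, at index 0. The outer [Some] distinguishes
    the letter [None] from the default value of [nth], which makes [sep_phi] zero past the end. *)
Definition sep_letters (s : syllables L) := rev [seq Some p.1.1 | p <- s].
Definition sep_times (s : syllables L) : seq int := pmap (fun p => omap snd p.1.1) s.

Definition sep_phi (s : syllables L) (l : L) (i : nat) : int :=
  if nth None (sep_letters s) i is Some l' then letter_poly (sep_times s) l l' else 0.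

Lemma letter_poly_refl T l : letter_poly T l l <> 0.
Proof.
case: l => [[x j]|] //=; rewrite eqxx => /eqP.
rewrite prodf_seq_eq0 => /hasP[t _ /andP[tj]]; rewrite subr_eq0 eq_sym.
by rewrite (negbTE tj).
Qed.

Lemma letter_poly_neq T x j l' : j \in T -> Some (x, j) != l' ->
  letter_poly T (Some (x, j)) l' = 0.
Proof.
case: l' => [[x' j']|] //= jT ne; case: eqP => // e; move: ne; rewrite -e => ne.
apply/eqP; rewrite prodf_seq_eq0; apply/hasP; exists j => //.
rewrite subrr eqxx andbT; apply: contra ne => /eqP -> //.
Qed.

Lemma letter_poly_sep s p l' : p \in s -> p.1.1 != l' ->
  letter_poly (sep_times s) p.1.1 l' = 0.
Proof.
case: p => [[[[x j]|] b] n] /= ps ne; last by case: l' ne.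
apply: letter_poly_neq => //; rewrite mem_pmap.
by apply/mapP; exists ((Some (x, j), b), n).
Qed.

Lemma deg_lt_letter_poly T x l' e g : deg_lt e g ->
  deg_lt (e + size T) (fun j => letter_poly T (Some (x, j)) l' * g j).
Proof.
move=> hg; case: l' => [[x' j']|] /=; last first.
  by apply: deg_lt_ext (deg_lt_zero _) => j; rewrite mul0r.
case: eqP => [_|_]; last by apply: deg_lt_ext (deg_lt_zero _) => j; rewrite mul0r.
elim: T => [|t T IH].
  by rewrite addn0; apply: deg_lt_ext hg => j; rewrite big_nil mul1r.
rewrite addnS; case tj : (t != j').
  by apply: deg_lt_ext (deg_lt_mul_linear t IH) => j; rewrite big_cons tj mulrA.
by apply: deg_lt_ext (deg_ltS IH) => j; rewrite big_cons tj.
Qed.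

(** Index [size t] carries the letter of the syllable in front of the suffix t. The adjacent indices
    carry the letters of neighbouring syllables, which differ since s is reduced, or the zero
    coefficient past the end. *)
Lemma sep_phi_separates s : reduced s -> separates (sep_phi s) s.
Proof.
move=> rs; suff: forall t p, s = p ++ t -> separates (sep_phi s) t by apply; exact: (erefl ([::] ++ s)).
elim=> [|x t IH] p es //=.
have xs : x \in s by rewrite es mem_cat mem_head orbT.
have pos i : nth None (sep_letters s) i =
    nth None (rcons (sep_letters t) (Some x.1.1) ++ sep_letters p) i.
  by rewrite /sep_letters es map_cat rev_cat /= rev_cons.
have st : size (sep_letters t) = size t by rewrite size_rev size_map.
split; last by apply: (IH (rcons p x)); rewrite cat_rcons.
- rewrite /sep_phi pos nth_cat size_rcons st ltnSn nth_rcons st ltnn eqxx.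
  exact: letter_poly_refl.
- rewrite /sep_phi pos nth_cat size_rcons st ltnn subnn.
  case: (lastP p) es => [|p' y] es //; rewrite /sep_letters map_rcons rev_rcons /=.
  apply: letter_poly_sep => //; move: rs; rewrite es /reduced cat_rcons.
  by move=> /cat_sorted2 [_] /= /andP[yx _]; rewrite eq_sym.
- case: t es {IH} pos st => [|z t] // es pos st _ /=.
  rewrite /sep_phi pos nth_cat size_rcons st /= ltnS leqnSn nth_rcons st /= ltnSn.
  rewrite /sep_letters /= rev_cons nth_rcons size_rev size_map ltnn eqxx.
  apply: letter_poly_sep => //; move: rs; rewrite es /reduced.
  by move=> /cat_sorted2 [_] /= /andP[].
Qed.
End SeparatingCoefficients.

(** * Residual nilpotence of surface groups *)

Lemma surface_group_residually_nilpotent h : residually_nilpotent (Gamma h.+1).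
Proof.
move=> u hu.
have [s rs us] := syllables_exist (K_word u 0%R).
(* [letter_poly] has at most [size (sep_times s)] linear factors, and Q >= 2 puts the time function
   j into component 0 of [filt Q 0]. *)
pose phi := sep_phi s; pose Q := (size (sep_times s)).+2.
have phi_deg x i e (g : int -> int) : deg_lt e g ->
    deg_lt (e + Q.-1) (fun j => phi (Some (x, j)) i * g j)%R.
  move=> hg; rewrite /phi /sep_phi; case: (nth _ _ _) => [l'|].
    apply: deg_lt_mono (deg_lt_letter_poly (sep_times s) x l' hg).
    by rewrite /Q /= leq_add2l.
  by apply: deg_lt_ext (deg_lt_zero _) => j; rewrite mul0r.
have fix_filt := act_residual (isT : 0 < Q) phi_deg hu.
have off0 : offset u = 0%R.
  (* The Magnus action leaves entry 0 unchanged, so on this f only the time shift by [offset u] is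
     visible there. *)
  pose f i (j : int) : int := if i is 0 then j else 0%R.
  have hf : filt Q 0 f.
    case=> [|i]; last exact: deg_lt_zero.
    apply: (@deg_lt_mono 2) => //= j; lia.
  have := fix_filt f hf 0 0%R; rewrite act_K_word.
  have [_ ->] := @magnus_unitriangular _ phi (K_word u 0%R)
    (fun i => f i (0 + offset u)%R) 0 (fun j => False_ind _ \o notF).
  by rewrite /= add0r.
(* On [vac], constant in time, u acts at time 0 through s and makes entry [size s] nonzero. As u
   fixes [vac], whose only nonzero entry is at 0, s is empty. *)
have s0 : s = [::].
  have hf : filt Q 0 (fun i _ => vac i).
    move=> i; apply: (@deg_lt_mono 1) => [|j /=]; last exact: subrr.
    by rewrite subn0 muln_gt0.
  have := fix_filt _ hf (size s) 0%R; rewrite act_K_word (magnus_freeq phi us).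
  have [] : _ /\ _ := @magnus_separates _ phi s (sep_phi_separates rs).
  move=> h0 _ h1; have {}h1 : magnus phi (of_syllables s) vac (size s) = vac (size s) := h1.
  by case: (s) h0 h1 => // p t h0 h1; case: h0; rewrite h1.
have W : wncl h.+1 u by apply: K_word_faithful off0; rewrite s0 in us.
have [_ _ hV hE _] := ncl_normal (free_group_is_group ('I_h.+1 * bool)) (fun s => s = surface_rel h.+1).
by apply: hE (hV _ W); have := free_group_is_group ('I_h.+1 * bool) => hF; group_id hF.
Qed.

(** * Comparison of phi(N) with the normal closure of w *)

Lemma Fg_generators g : exists gens : seq (Fg g), forall x, gen (fun y => List.In y gens) x.
Proof.
pose lt (y : 'I_g * bool) : Fg g := [:: (y, false)].
exists (map lt (enum {: 'I_g * bool})).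
have hlt y : gen (fun z => List.In z (map lt (enum {: 'I_g * bool}))) (lt y).
  apply: gen_in; have : y \in enum {: 'I_g * bool} by rewrite mem_enum.
  elim: (enum _) => [|z s IH] //; rewrite in_cons => /orP[/eqP <-|/IH]; [by left|by right].
elim=> [|[y b] x IH]; first exact: gen_one.
apply: (@gen_mul _ _ ([:: (y, b)] : Fg g) x _ IH).
case: b; last exact: hlt.
exact: (gen_inv (hlt y)).
Qed.

Theorem theorem4 (g : nat) (hg : 2 <= g) (N : Fg g -> Prop)
  (hN : is_normal N)
  (hlcs : forall k : nat, 1 <= k ->
     isomorphic (quot (gamma (quot N) k)) (quot (gamma (Gamma g) k))) :
  ((exists phi : Fg g -> Fg g, is_iso phi /\
       (forall y, wncl g y -> gimage phi N y)) ->
     isomorphic (quot N) (Gamma g)) /\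
  ((exists phi : Fg g -> Fg g, is_iso phi /\
       (forall y, gimage phi N y -> wncl g y) /\
       (exists y, wncl g y /\ ~ gimage phi N y)) ->
     ~ residually_nilpotent (quot N)).
Proof.
have hF : is_group (Fg g) := free_group_is_group _.
have hW : @is_normal (Fg g) (wncl g) := ncl_normal hF _.
have hQN := quot_group hF hN.
have [gens gensP] := Fg_generators g.
have hM (phi : Fg g -> Fg g) : is_iso phi -> is_normal (gimage phi N) by move=> h; apply: gimage_normal.
have iso_phi (phi : Fg g -> Fg g) : is_iso phi -> @is_iso (quot N) (quot (gimage phi N)) phi.
  move=> h; apply: iso_quot => //; first exact: hM.
  by apply: gimage_iff => //; apply: geq_refl.
have iso_gamma (phi : Fg g -> Fg g) k : is_iso phi ->
    isomorphic (quot (gamma (quot N) k)) (quot (gamma (quot (gimage phi N)) k)).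
  move=> h; have hQM := quot_group hF (hM _ h).
  by apply: isomorphic_quot_gamma => //; exists phi; apply: iso_phi.
split=> [[phi [hphi Wsub]]|[phi [hphi [subW [y [Wy My]]]]] rn].
  exists phi; apply: iso_quot => // x.
  have [NM MN] := gimage_iff hphi hN (geq_refl hF) x.
  split=> [/NM Mx|/Wsub/MN //].
  have rn : residually_nilpotent (Gamma g).
    by case: (g) hg => // h _; apply: surface_group_residually_nilpotent.
  (* The comparison lemma is used with M1 = <<w>> and M2 = phi(N). *)
  have hxg k : 0 < k -> gamma (Gamma g) k (phi x).
    move=> k_gt0; apply: (same_nilpotent_quotients hF gensP hW (hM _ hphi) Wsub _ Mx).
    have hQM := quot_group hF (hM _ hphi).
    apply: isomorphic_trans (iso_gamma _ k hphi).
      by apply: (quot_group hQM); apply: lcs_normal.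
    apply: isomorphic_sym (hlcs k k_gt0).
    by apply: (quot_group (Gamma_group g)); apply: lcs_normal; apply: Gamma_group.
  have W1 := rn _ hxg.
  by have [_ _ WV WE _] := hW; apply: WE (WV _ W1); group_id hF.
(* The roles are exchanged: M1 = phi(N) and M2 = <<w>>. The element y of <<w>> outside phi(N) is
   phi(x), and x lies in every gamma_k(G), so residual nilpotence would put x in N. *)
have [_ _ _ phiS] := hphi; have [x xy] := phiS y.
apply: My; exists x; split=> //.
suff : @geq (quot N) x gone.
  by have [_ _ NV NE _] := hN => /NV; apply: NE; group_id hF.
apply: rn => k k_gt0; have hQM := quot_group hF (hM _ hphi).
apply/(iso_lcs hQN hQM k.-1 (iso_phi _ hphi)).
have [_ _ _ WE _] := hW.
apply: (same_nilpotent_quotients hF gensP (hM _ hphi) hW subW).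
  have hT := isomorphic_sym _ (iso_gamma _ k hphi).
  apply: isomorphic_trans (hT _) (hlcs k k_gt0).
    by apply: (quot_group (Gamma_group g)); apply: lcs_normal; apply: Gamma_group.
  by apply: (quot_group hQM); apply: lcs_normal.
by apply: WE Wy; apply: geq_sym.
Qed.
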